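(* Let $p$ be a prime and let $A$ be a multiplicative subgroup of $\mathbb Z_p^*$ with $|A|\gg p^{\frac {11}{23}}\log^{\frac{15}{23}}(|A|)$. Then $6A\supseteq\mathbb Z_p^*$.
   Context: For $k\ge1$, $kA=\{x_1+\dots+x_k: x_i\in A\}$ is the $k$-fold sumset. The notation $X\gg Y$ means $X\ge CY$ for a suitable absolute constant $C>0$.
   Formalization: The theorem assumes |A| ≥ 2: for the trivial subgroup A = {1} one has log|A| = 0, so the size condition holds for every constant, yet 6A = {6} never contains Z_p^*. *)

(* Defs.v *)
From HB Require Import structures.
From mathcomp Require Import all_boot all_order all_algebra all_fingroup.
From mathcomp Require Import reals exp.

Set Implicit Arguments.
Unset Strict Implicit.
Unset Printing Implicit Defensive.

Import Order.TTheory GRing.Theory Num.Theory.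
Local Open Scope ring_scope.

Definition sumset (T : finZmodType) (k : nat) (A : {set T}) : {set T} :=
  [set \sum_(i < k) x i | x : {ffun 'I_k -> T} in ffun_on (mem A)].

(* A subset of the group of units of 'F_p, seen as a subset of 'F_p, where
   sums can be formed. *)
Definition units_in_Fp (p : nat) (A : {set {unit 'F_p}}) : {set 'F_p} :=
  [set val u | u in A].

(* Main.v *)
Require Import Defs.
From HB Require Import structures.
From mathcomp Require Import all_boot all_order all_algebra all_fingroup.
From mathcomp Require Import reals exp.
From mathcomp Require Import cyclic all_field sequences zify ring lra.

Set Implicit Arguments.
Unset Strict Implicit.
Unset Printing Implicit Defensive.

Import Order.TTheory GRing.Theory Num.Theory.
Local Open Scope ring_scope.


(* Write n = #|A|, so that A is the set of n-th roots of unity in F_p.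

   Stepanov's method bounds N(u, v) = #{x : x^n = u, (x - 1)^n = v}: an auxiliary
   polynomial F(X, X^n, (X - 1)^n) vanishing to high order at the points of T
   classes (u, v) shows that they contain O((nT)^(2/3)) points, whence the sum of
   N^3 over the classes where N is large is O(n^2 log n).

   (1) The number of (a + 1)(b + 1) = (c + 1)(d + 1) is controlled by these cubes,
       so it is O(n^2 log n) in the critical range.  Since
       (a + 1)(b + 1) - 1 = ab + a + b lies in 3A, we get |3A| >> n^2 / log n.
   (2) By Cauchy-Schwarz, the additive energy E of A is O(n^(5/2) log^(1/2) n).
   (3) Invariance of A gives |A^(xi)|^8 <= p E^2 for xi <> 0.  If some nonzero a
       is not in 6A, then 3A + 3A misses aA, and Fourier analysis yields
       (|3A| n)^8 <= p^9 E^2.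

   Together n^19 = O(p^9 log^9 n), which the hypothesis excludes because
   9/19 < 11/23.  When n^3 > 2 p^2 already 4A is everything. *)


(** * Sparse polynomials of degree below the characteristic *)

Definition char_ge (F : fieldType) (p : nat) :=
  forall k, (0 < k < p)%N -> k%:R != 0 :> F.

Lemma char_ge_inj (F : fieldType) p i j :
  char_ge F p -> (i < p)%N -> (j < p)%N -> i != j -> i%:R - j%:R != 0 :> F.
Proof.
move=> hF ip jp; rewrite neq_ltn => /orP[lt|lt].
  rewrite -opprB oppr_eq0 -natrB ?(ltnW lt) //; apply: hF; lia.
rewrite -natrB ?(ltnW lt) //; apply: hF; lia.
Qed.

Lemma dvdp_deriv_exp (F : fieldType) (x : F) m (f : {poly F}) :
  ('X - x%:P) ^+ m.+1 %| f -> ('X - x%:P) ^+ m %| f^`().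
Proof.
case/dvdpP=> q ->; rewrite derivM deriv_exp derivXsubC mul1r /=.
by rewrite dvdp_add ?dvdp_mull ?dvdp_exp2l // -mulr_natr dvdp_mulr.
Qed.

(** Vanishing to order [m] at 1 is a Vandermonde system in the exponents, which stay distinct in [F]
    because they are below [p]. The induction removes one monomial at a time. *)
Lemma sparse_poly_eq0 (F : fieldType) p m (h : {poly F}) :
  char_ge F p -> (size h <= p)%N -> ('X - 1%:P) ^+ m %| h ->
  (#|[set i : 'I_p | (h`_i != 0)%R]| <= m)%N -> h = 0.
Proof.
move=> hF; elim: m h => [|m IH] h hp hdvd hcard.
  apply/polyP=> i; rewrite coef0; case: (ltnP i p) => [ip|]; last first.
    by move=> pi; apply: nth_default; apply: leq_trans pi.
  move: hcard; rewrite leqn0 cards_eq0 => /eqP/setP/(_ (Ordinal ip)).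
  by rewrite !inE /= => /negbFE/eqP.
case: (set_0Vmem [set i : 'I_p | (h`_i != 0)%R]) => [h0|[e]].
  by apply: IH => //; [apply: dvdp_trans hdvd; rewrite dvdp_exp2l|rewrite h0 cards0].
rewrite inE => he.
(* X h' - e h loses the monomial of degree e and only one order of vanishing at 1. *)
pose g := 'X * h^`() - e%:R *: h.
have gE i : g`_i = (i%:R - e%:R) * h`_i.
  rewrite coefB coefXM coefZ coef_deriv mulrBl; case: i => [|i] /=; first by rewrite mul0r.
  by rewrite -[h`_i.+1 *+ _]mulr_natl.
have g0 : g = 0.
  apply: IH.
  - rewrite (leq_trans (size_polyD _ _)) // size_polyN geq_max (leq_trans (size_scale_leq _ _)) // andbT.
    have [->|hn0] := eqVneq h 0; first by rewrite deriv0 mulr0 size_poly0.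
    rewrite (leq_trans (size_polyMleq _ _)) // size_polyX /= add0n ?addSn /=.
    by apply: leq_trans hp; apply: lt_size_deriv.
  - rewrite dvdp_sub ?dvdp_mull ?dvdp_deriv_exp // -mul_polyC dvdp_mull //.
    by apply: dvdp_trans hdvd; rewrite dvdp_exp2l.
  - rewrite -ltnS; apply: leq_trans hcard; apply: proper_card.
    apply/properP; split; last by exists e; rewrite !inE ?gE ?subrr ?mul0r ?eqxx.
    by apply/subsetP=> i; rewrite !inE gE mulf_eq0 negb_or => /andP[].
(* [g = 0] leaves only the monomial of degree [e], and a nonzero monomial does not vanish at 1. *)
have hi i : (i < p)%N -> i != e -> h`_i = 0.
  move=> ip ie; have := gE i; rewrite g0 coef0 => /esym/eqP; rewrite mulf_eq0.
  by rewrite (negPf (char_ge_inj hF ip (ltn_ord e) ie)) => /eqP.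
have hE : h = h`_e *: 'X^e.
  apply/polyP=> i; rewrite coefZ coefXn; have [->|ie] := eqVneq i e; first by rewrite mulr1.
  rewrite mulr0; case: (ltnP i p) => [ip|pi]; first exact: hi.
  by apply: nth_default; apply: leq_trans pi.
have : root h 1.
  by rewrite root_factor_theorem; apply: dvdp_trans hdvd; rewrite dvdp_exp.
by rewrite hE rootE hornerZ hornerXn expr1n mulr1 (negPf he).
Qed.

(** * The operator [X (X - 1) d/dX] and orders of vanishing *)

Section Theta.
Variable F : fieldType.
Implicit Types f g : {poly F}.

(* Away from 0 and 1, theta lowers the order of vanishing by one, but unlike the
   plain derivative it maps f X^m (X - 1)^l to a polynomial of the same shape. *)
Definition theta f := 'X * ('X - 1%:P) * f^`().

Lemma theta_sum (I : finType) (l : I -> F) (f : I -> {poly F}) k :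
  iter k theta (\sum_i l i *: f i) = \sum_i l i *: iter k theta (f i).
Proof.
elim: k => //= k ->; rewrite /theta linear_sum mulr_sumr.
by apply: eq_bigr => i _; rewrite /= derivZ scalerAr.
Qed.

(** The factor [X (X - 1)] is coprime to [X - x], so induction makes [f'] divisible by [(X - x)^K].
    A root of multiplicity at most [K] would lose exactly one order under differentiation, its
    multiplicity being below [p] and hence nonzero in [F]. *)
Lemma dvdp_theta p f x K : char_ge F p -> (K <= p)%N -> x != 0 -> x != 1 ->
  (forall k, (k < K)%N -> (iter k theta f).[x] = 0) -> ('X - x%:P) ^+ K %| f.
Proof.
move=> hF + x0 x1; elim: K f => [|K IH] f Kp h; first by rewrite expr0 dvd1p.
have hd : ('X - x%:P) ^+ K %| f^`().
  have : ('X - x%:P) ^+ K %| theta f.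
    by apply: IH => [|k kK]; [exact: ltnW | rewrite -iterSr; apply: h].
  rewrite Gauss_dvdpr // coprimep_expl // coprimepMr.
  rewrite -{2}['X]subr0 -[0]/(0%:P) !coprimep_XsubC !root_XsubC.
  by rewrite eq_sym x0 eq_sym x1.
have [->|fn0] := eqVneq f 0; first by rewrite dvdp0.
case: (multiplicity_XsubC f x) => m [q]; rewrite fn0 /= => qx fE.
case: (ltnP K m) => [Km|mK]; first by rewrite fE dvdp_mull // dvdp_exp2l.
case: m mK fE => [|m] mK fE.
  have := h 0%N isT; rewrite /= fE expr0 mulr1 => /eqP.
  by rewrite -/(root q x) (negPf qx).
move: hd; rewrite fE derivM deriv_exp derivXsubC mul1r /= exprS => hd.
have : ('X - x%:P) ^+ m.+1 %| q^`() * (('X - x%:P) * ('X - x%:P) ^+ m) +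
     q * (('X - x%:P) ^+ m *+ m.+1) by apply: dvdp_trans hd; apply: dvdp_exp2l.
rewrite -exprS (dvdp_addr _ (dvdp_mull _ (dvdpp _))) -[_ *+ m.+1]mulr_natr mulrA => hd'.
have : ('X - x%:P) %| q * m.+1%:R.
  have : ('X - x%:P) ^+ m * ('X - x%:P) %| ('X - x%:P) ^+ m * (q * m.+1%:R).
    by rewrite -exprSr mulrA [_ * q]mulrC.
  by rewrite dvdp_mul2l // expf_neq0 // polyXsubC_eq0.
rewrite -root_factor_theorem rootM (negPf qx) /= rootE -polyC_natr hornerC.
by rewrite (negPf (hF _ _)) //; lia.
Qed.

(** What [theta] leaves in front of [X^m (X - 1)^l]. Its degree rises by at most one per step
    whatever [m] and [l], which keeps the number of linear conditions small. *)
Fixpoint theta_cofactor (m l : nat) f (k : nat) : {poly F} :=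
  if k is k'.+1 then
    let q := theta_cofactor m l f k' in
    'X * ('X - 1%:P) * q^`() + (m%:R *: ('X - 1%:P) + l%:R *: 'X) * q
  else f.

Lemma iter_theta m l f k : iter k theta (f * 'X^m * ('X - 1%:P) ^+ l) =
  theta_cofactor m l f k * 'X^m * ('X - 1%:P) ^+ l.
Proof.
elim: k => //= k ->; rewrite /theta.
set q := theta_cofactor m l f k.
have hX : 'X * ('X^m)^`() = m%:R *: 'X^m :> {poly F}.
  by rewrite derivXn; case: m {q} => [|m]; rewrite ?mulr0n ?mulr0 ?scale0r // mulrnAr -exprS scaler_nat.
have hY : ('X - 1%:P) * (('X - 1%:P) ^+ l)^`() = l%:R *: ('X - 1%:P) ^+ l :> {poly F}.
  rewrite deriv_exp derivXsubC mul1r; case: l {q} => [|l]; rewrite ?mulr0n ?mulr0 ?scale0r //.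
  by rewrite mulrnAr -exprS scaler_nat.
rewrite !derivM.
transitivity ('X * ('X - 1%:P) * q^`() * 'X^m * ('X - 1%:P) ^+ l +
  ('X - 1%:P) * q * ('X * ('X^m)^`()) * ('X - 1%:P) ^+ l +
  'X * q * 'X^m * (('X - 1%:P) * (('X - 1%:P) ^+ l)^`())); first by ring.
by rewrite hX hY -!mul_polyC; ring.
Qed.

Lemma size_theta_cofactor m l f k : (size (theta_cofactor m l f k) <= size f + k)%N.
Proof.
elim: k => [|k IH] /=; first by rewrite addn0.
set q := theta_cofactor m l f k in IH *.
have [->|q0] := eqVneq q 0; first by rewrite deriv0 !mulr0 addr0 size_poly0.
rewrite (leq_trans (size_polyD _ _)) // geq_max; apply/andP; split.
  apply: leq_trans (size_polyMleq _ _) _.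
  set r := 'X * ('X - 1%:P); have : (size r <= 3)%N.
    by apply: leq_trans (size_polyMleq _ _) _; rewrite size_polyX size_XsubC.
  move: (lt_size_deriv q0) IH.
  by move: (size r) (size q) (size _^`()) (size f) => ? ? ? ?; lia.
apply: leq_trans (size_polyMleq _ _) _.
set r := _ *: _ + _; have : (size r <= 2)%N.
  apply: leq_trans (size_polyD _ _) _; rewrite geq_max.
  by rewrite !(leq_trans (size_scale_leq _ _)) ?size_XsubC ?size_polyX.
by move: IH; move: (size r) (size q) (size f) => ? ? ?; lia.
Qed.
End Theta.

(** * Linear relations and independence of the auxiliary monomials *)

Lemma exists_linear_relation (F : fieldType) (I C : finType) (M : C -> I -> F) :
  (#|C| < #|I|)%N ->
  exists2 l : I -> F, (exists i, l i != 0) & forall c, \sum_i l i * M c i = 0.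
Proof.
move=> ltCI.
pose A : 'M[F]_(#|I|, #|C|) := \matrix_(i, j) M (enum_val j) (enum_val i).
have : kermx A != 0.
  rewrite -mxrank_eq0 mxrank_ker subn_eq0 -ltnNge.
  exact: leq_ltn_trans (rank_leq_col A) ltCI.
case/rowV0Pn=> u /sub_kermxP uA u0.
exists (fun i => u 0 (enum_rank i)).
  case/rV0Pn: u0 => i ui; exists (enum_val i); by rewrite enum_valK.
move=> c; have := congr1 (fun v : 'rV_ _ => v 0 (enum_rank c)) uA.
rewrite !mxE => uAc; rewrite -[RHS]uAc (reindex_onto (@enum_val I I) enum_rank) /=; last first.
  by move=> i _; rewrite enum_rankK.
apply: eq_big => [i|i _]; first by rewrite enum_valK eqxx.
by rewrite mxE enum_rankK enum_valK.
Qed.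

Lemma prod_XsubC_exp_dvdp (F : fieldType) (s : seq F) K (f : {poly F}) : uniq s ->
  (forall x, x \in s -> ('X - x%:P) ^+ K %| f) ->
  \prod_(x <- s) ('X - x%:P) ^+ K %| f.
Proof.
elim: s => [|x s IH] /=; first by rewrite big_nil dvd1p.
case/andP=> xs us h; rewrite big_cons Gauss_dvdp.
  by rewrite h ?mem_head // IH // => y ys; apply: h; rewrite inE ys orbT.
elim: s xs {IH us h} => [|y s IH]; first by rewrite big_nil coprimep1.
rewrite inE negb_or => /andP[xy xs]; rewrite big_cons coprimepMr IH // andbT.
by rewrite coprimep_expl // coprimep_expr // coprimep_XsubC root_XsubC eq_sym.
Qed.

(** Modulo [y] only the term [l = 0] survives, so it is divisible by [y] and vanishes; dividing by
    [y] continues the induction. *)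
Lemma sum_mul_exp_eq0 (F : fieldType) (y : {poly F}) b (P : 'I_b -> {poly F}) :
  y != 0 -> (forall l, y %| P l -> P l = 0) ->
  \sum_l P l * y ^+ l = 0 -> forall l, P l = 0.
Proof.
move=> y0; elim: b P => [|b IH] P hP; first by move=> _ [m i]; have := i; rewrite ltn0.
rewrite big_ord_recl expr0 mulr1.
under eq_bigr => i _ do rewrite lift0 exprSr mulrA.
rewrite -mulr_suml => /eqP h.
have P0 : P ord0 = 0.
  by apply: hP; move: h; rewrite addr_eq0 => /eqP->; rewrite dvdpNr dvdp_mull.
move: h; rewrite P0 add0r mulf_eq0 (negPf y0) orbF => /eqP h l.
case: (unliftP ord0 l) => [j|] ->; last exact: P0.
exact: (IH (fun j => P (lift ord0 j)) (fun j => hP (lift ord0 j)) h j).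
Qed.

Section Independence.
Variables (F : fieldType) (p n a b : nat) (l : 'I_a * 'I_b * 'I_b -> F).
Hypotheses (hF : char_ge F p) (abn : (a * b <= n)%N) (nbp : (n * b <= p)%N).

Definition stepanov_monomial (i : 'I_a * 'I_b * 'I_b) : {poly F} :=
  'X^(i.1.1) * 'X^(n * i.1.2) * ('X - 1%:P) ^+ (n * i.2).

(** Grouped by powers of [(X - 1)^n], the relation has coefficients with at most [a * b <= n]
    monomials, of degree below [n * b <= p]. By sparsity a nonzero one is not divisible by
    [(X - 1)^n], so all of them vanish. *)
Lemma stepanov_independent :
  \sum_i l i *: stepanov_monomial i = 0 -> forall i, l i = 0.
Proof.
move=> h0 [[i0 j0] k0].
have a0 : (0 < a)%N by case: (a) i0 => [[]|].
have b0 : (0 < b)%N by case: (b) j0 => [[]|].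
have n0 : (0 < n)%N by apply: leq_trans abn; rewrite muln_gt0 a0.
have an : (a <= n)%N by apply: leq_trans abn; rewrite leq_pmulr.
have p0 : (0 < p)%N by apply: leq_trans nbp; rewrite muln_gt0 n0.
pose P k : {poly F} := \sum_(ij : 'I_a * 'I_b) l (ij, k) *: 'X^(ij.1 + n * ij.2).
have coefP k e : (P k)`_e = \sum_(ij : 'I_a * 'I_b) l (ij, k) * (e == ij.1 + n * ij.2)%N%:R.
  by rewrite coef_sum; apply: eq_bigr => ij _; rewrite coefZ coefXn.
have lt_nb (ij : 'I_a * 'I_b) : (ij.1 + n * ij.2 < n * b)%N.
  have := ltn_ord ij.1; have := ltn_ord ij.2.
  move: (nat_of_ord ij.1) (nat_of_ord ij.2) => i j jb ia.
  have : (n * j.+1 <= n * b)%N by rewrite leq_mul2l jb orbT.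
  by rewrite mulnS; lia.
have Pk : P k0 = 0.
  apply: (@sum_mul_exp_eq0 F (('X - 1%:P) ^+ n) b P _ _ _ k0).
  - by rewrite expf_neq0 // polyXsubC_eq0.
  - move=> k hk; apply: (sparse_poly_eq0 hF _ hk).
      apply: (leq_trans _ nbp); apply/leq_sizeP=> e he; rewrite coefP big1 // => ij _.
      case: eqP => [E|]; last by rewrite mulr0.
      by have := lt_nb ij; rewrite -E ltnNge he.
    apply: leq_trans abn; have <- : #|{: 'I_a * 'I_b}| = (a * b)%N by rewrite card_prod !card_ord.
    (* The default value is never taken: every exponent [i + n j] is below [n * b <= p]. *)
    pose f (ij : 'I_a * 'I_b) : 'I_p := insubd (Ordinal p0) (ij.1 + n * ij.2)%N.
    apply: leq_trans (leq_imset_card f predT); apply: subset_leq_card.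
    apply/subsetP=> e; rewrite inE coefP => he.
    case: (pickP (fun ij : 'I_a * 'I_b => e == ij.1 + n * ij.2 :> nat)%N) => [ij /eqP eij|none].
      apply/imsetP; exists ij => //; apply: val_inj.
      by rewrite /f val_insubd -eij ltn_ord.
    by rewrite big1 ?eqxx // in he => ij _; rewrite none mulr0.
  - rewrite -[RHS]h0; transitivity (\sum_ij \sum_k l (ij, k) *: stepanov_monomial (ij, k)); last first.
      by rewrite pair_bigA; apply: eq_bigr => -[].
    rewrite exchange_big; apply: eq_bigr => k _; rewrite mulr_suml; apply: eq_bigr => ij _.
    by rewrite /stepanov_monomial /= -scalerAl -exprD exprM.
have := coefP k0 (i0 + n * j0)%N; rewrite Pk coef0 (bigD1 (i0, j0)) //= eqxx mulr1.
rewrite big1 ?addr0 // => -[i j]; rewrite xpair_eqE /= => ne.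
case: eqP => [E|]; last by rewrite mulr0.
(* Since [i < a <= n], remainder and quotient by [n] recover [i] and [j] from [i + n j]. *)
have Ei : i0 = i :> nat.
  have := congr1 (modn^~ n) E.
  by rewrite /= !(addnC _ (n * _)%N) !(mulnC n) !modnMDl !modn_small // (leq_trans _ an).
have Ej : j0 = j :> nat.
  by move: E; rewrite Ei => /addnI/eqP; rewrite eqn_pmul2l // => /eqP.
by rewrite (val_inj Ei) (val_inj Ej) !eqxx in ne.
Qed.
End Independence.

(* If n | #|F| - 1, the values x^n and (x - 1)^n encode the cosets of x and x - 1
   modulo the group of n-th roots of unity. *)
Definition power_class (F : fieldType) n (x : F) : F * F := (x ^+ n, (x - 1) ^+ n).

Definition class_points (F : finFieldType) n (J : {set F * F}) : {set F} :=
  [set x | [&& x != 0, x != 1 & power_class n x \in J]].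

(** * Stepanov's bound and the number of popular classes *)

Section Stepanov.
Variables (F : finFieldType) (p n : nat).
Hypothesis hF : char_ge F p.

(* On a class (u, v) the k-th theta-derivative of the auxiliary polynomial agrees
   with a polynomial of degree < a + K, whose coefficients are made to vanish. *)
Lemma stepanov (a b K : nat) (J : {set F * F}) :
  (a * b <= n)%N -> (n * b <= p)%N -> (K <= p)%N ->
  (#|J| * K * (a + K) < a * b * b)%N ->
  (K * #|class_points n J| <= a + 2 * n * b)%N.
Proof.
move=> abn nbp Kp ltC.
(* [C] indexes the conditions: a class in [J], an order [k < K], a coefficient below [a + K]. The
   unknowns are the [a * b * b] coefficients of the auxiliary polynomial. *)
pose C := ({u : F * F | u \in J} * 'I_K * 'I_(a + K))%type.
pose M (c : C) (i : 'I_a * 'I_b * 'I_b) : F :=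
  (val c.1.1).1 ^+ i.1.2 * (val c.1.1).2 ^+ i.2 *
  (theta_cofactor (n * i.1.2) (n * i.2) 'X^(i.1.1) c.1.2)`_(c.2).
have [|l [i0 li0] hl] := @exists_linear_relation F _ C M.
  by rewrite !card_prod !card_ord card_sig.
pose f := \sum_i l i *: @stepanov_monomial F n a b i.
have f0 : f != 0.
  by apply: contraNneq li0 => /(stepanov_independent hF abn nbp)->.
have size_f : (size f <= a + 2 * n * b)%N.
  apply: leq_trans (size_sum _ _ _) _; apply/bigmax_leqP => -[[i j] k] _.
  apply: leq_trans (size_scale_leq _ _) _; rewrite /stepanov_monomial /=.
  apply: leq_trans (size_polyMleq _ _) _; rewrite -exprD size_polyXn size_exp_XsubC addnS /=.
  have := ltn_ord i.
  have : (n * j <= n * b)%N by rewrite leq_mul2l (ltnW (ltn_ord j)) orbT.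
  have : (n * k <= n * b)%N by rewrite leq_mul2l (ltnW (ltn_ord k)) orbT.
  rewrite -mulnA mul2n -addnn.
  by move: (n * k)%N (n * j)%N (n * b)%N (nat_of_ord i) => ? ? ? ?; lia.
have dvd_f x : x \in class_points n J -> ('X - x%:P) ^+ K %| f.
  rewrite inE => /and3P[x0 x1 xJ]; apply: (dvdp_theta hF) => // k kK.
  rewrite theta_sum horner_sum.
  pose c (e : 'I_(a + K)) : C := (exist _ (power_class n x) xJ, Ordinal kK, e).
  transitivity (\sum_(e < a + K) (\sum_i l i * M (c e) i) * x ^+ e); last first.
    by rewrite big1 // => e _; rewrite hl mul0r.
  under [RHS]eq_bigr => e _ do rewrite mulr_suml.
  rewrite exchange_big; apply: eq_bigr => -[[i j] m] _.
  rewrite hornerZ /stepanov_monomial iter_theta !hornerM hornerXn horner_exp hornerXsubC.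
  rewrite (@horner_coef_wide _ (a + K)); last first.
    apply: leq_trans (size_theta_cofactor _ _ _ _) _; rewrite size_polyXn addSn -addnS.
    by apply: leq_add => //; apply: ltnW; apply: ltn_ord.
  rewrite -mulrA mulr_suml mulr_sumr; apply: eq_bigr => e _.
  by rewrite /M /= !exprM; ring.
pose g := \prod_(x <- enum (class_points n J)) ('X - x%:P).
have : (size (g ^+ K) <= size f)%N.
  apply: dvdp_leq => //; rewrite -prodrXl; apply: prod_XsubC_exp_dvdp; first exact: enum_uniq.
  by move=> x; rewrite mem_enum; apply: dvd_f.
have g0 : g ^+ K != 0.
  by rewrite expf_neq0 // monic_neq0 // monic_prod_XsubC.
have := size_exp g K; rewrite size_prod_XsubC /= -cardE mulnC => <- h.
by apply: leq_trans size_f; apply: leq_trans h; exact: leq_pred.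
Qed.

(** With [a = K] and [b = n / K], Stepanov's bound gives [K^2 r <= 3 n^2] for [r] points, and the
    largest admissible [K] has [K^3] of order [n^2 / T] for [T] classes. The last hypothesis makes
    [k0] admissible, so [K >= k0] and [n b <= n^2 / k0 <= p]. *)
Lemma card_class_points_le (k0 : nat) (J : {set F * F}) :
  (0 < n <= p)%N -> (n ^ 2 <= k0 * p)%N -> (0 < #|J|)%N -> (16 * k0 ^ 3 * #|J| <= n ^ 2)%N ->
  (#|class_points n J| ^ 3 <= 27 * 128 ^ 2 * n ^ 2 * #|J| ^ 2)%N.
Proof.
move=> /andP[n0 np] hk0 J0 hJ; set T := #|J| in J0 hJ *; set r := #|class_points n J|.
have k00 : (0 < k0)%N by rewrite lt0n; apply: contraTneq hk0 => ->; rewrite -ltnNge mul0n expn_gt0 n0.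
(* The largest order of vanishing allowed, used with a = K and b = n / K. *)
pose P K := (16 * K ^ 3 * T <= n ^ 2)%N.
have exP : exists K, P K by exists k0.
have ubP K : P K -> (K <= n)%N.
  rewrite /P => h; case: (leqP K n) => // nK.
  have : (K ^ 3 <= n ^ 2)%N by apply: leq_trans h; nia.
  have : (n ^ 2 < K ^ 2)%N by rewrite ltn_exp2r.
  by rewrite !expnS expn0; nia.
case: (ex_maxnP exP ubP) => K hK maxK.
have k0K : (k0 <= K)%N by apply: maxK.
have K0 : (0 < K)%N := leq_trans k00 k0K.
have Kn : (K <= n)%N := ubP _ hK.
(* Maximality of [K] and [K + 1 <= 2 K]: the constant is [128 = 16 * 2^3]. *)
have hK1 : (n ^ 2 < 128 * K ^ 3 * T)%N.
  have : ~~ P K.+1 by apply/negP => /maxK; rewrite ltnn.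
  rewrite /P -ltnNge => h; apply: leq_trans h _.
  rewrite leq_mul2r; apply/orP; right.
  apply: (@leq_trans (16 * (2 * K) ^ 3)); last by rewrite expnMn mulnA.
  by rewrite leq_mul2l /= leq_exp2r //; lia.
set b := (n %/ K)%N.
have bKn : (K * b <= n)%N by rewrite mulnC leq_trunc_div.
have nbK : (n < 2 * (K * b))%N.
  have := ltn_ceil n K0; rewrite -/b mulSn mulnC.
  have : (0 < b)%N by rewrite divn_gt0.
  by nia.
have nbp : (n * b <= p)%N.
  rewrite -(leq_pmul2l k00) (leq_trans _ hk0) // expnS expn1 mulnCA leq_mul2l.
  by rewrite (leq_trans _ bKn) ?orbT // leq_mul2r k0K orbT.
(* From [16 K^3 T <= n^2 < 4 K^2 b^2] follows [4 K T < b^2], more than the [2 K T < b^2]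
   required. *)
have ltC : (T * K * (K + K) < K * b * b)%N.
  have h1 : (n ^ 2 < (2 * (K * b)) ^ 2)%N by rewrite ltn_exp2r.
  have := leq_ltn_trans hK h1; rewrite !expnS !expn0 => h2.
  rewrite -(ltn_pmul2l K0) -(@ltn_pmul2l 4) //; move: h2; nia.
have := stepanov bKn nbp (leq_trans Kn np) ltC; rewrite -/r => hr.
have hr2 : (K ^ 2 * r <= 3 * n ^ 2)%N.
  have h1 : (K * (K * r) <= K * (K + 2 * n * b))%N by rewrite leq_mul2l hr orbT.
  have h2 : (n * (K * b) <= n * n)%N by rewrite leq_mul2l bKn orbT.
  have h3 : (K * K <= n * n)%N by apply: leq_mul.
  by rewrite !expnS !expn0; nia.
(* To eliminate [K], the cube of one bound is multiplied by the square of the other; [K^6] and [n^4]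
   cancel. *)
have h3 : ((K ^ 2 * r) ^ 3 <= (3 * n ^ 2) ^ 3)%N by rewrite leq_exp2r.
have h4 : ((n ^ 2) ^ 2 <= (128 * K ^ 3 * T) ^ 2)%N by rewrite leq_exp2r // ltnW.
have K6 : (0 < K ^ 6)%N by rewrite expn_gt0 K0.
have n4 : (0 < n ^ 4)%N by rewrite expn_gt0 n0.
rewrite -(leq_pmul2l n4) -(leq_pmul2l K6).
have := leq_mul h4 h3.
set L := (_ * _)%N; set R := (_ * _)%N => LR.
apply: (@leq_trans L); first by rewrite /L eq_leq //; ring.
by apply: leq_trans LR _; rewrite /R eq_leq //; ring.
Qed.

Definition fiber (u : F * F) := #|class_points n [set u]|.

Lemma card_class_points J : #|class_points n J| = (\sum_(u in J) fiber u)%N.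
Proof.
rewrite -sum1_card (partition_big (@power_class F n) (mem J)) /=; last first.
  by move=> x; rewrite inE => /and3P[].
apply: eq_bigr => u uJ; rewrite /fiber -sum1_card; apply: eq_bigl => x.
rewrite !inE -!andbA; apply/and4P/and3P => [[-> -> _ ->]|[-> -> /eqP->]] //.
Qed.

(** For few enough popular classes [J], the previous bound makes [(#|J| v)^3] at most a constant
    times [n^2 #|J|^2], as wanted. Were there too many, a subset of [t] of them would force
    [v < 256 k0]. *)
Lemma card_popular (k0 v : nat) :
  (0 < n <= p)%N -> (n ^ 2 <= k0 * p)%N -> (16 * k0 ^ 3 <= n ^ 2)%N -> (256 * k0 <= v)%N ->
  (#|[set u | v <= fiber u]| * v ^ 3 <= 27 * 128 ^ 2 * n ^ 2)%N.
Proof.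
move=> hn hk0 h16 hv; set P := [set u | _].
have bound (J : {set F * F}) : J \subset P -> (16 * k0 ^ 3 * #|J| <= n ^ 2)%N ->
    (#|J| * v ^ 3 <= 27 * 128 ^ 2 * n ^ 2)%N.
  move=> JP hJ; have [->|J0] := posnP #|J|; first by rewrite mul0n.
  rewrite -(@leq_pmul2l (#|J| ^ 2)) ?expn_gt0 ?J0 //.
  rewrite [X in (_ <= X)%N]mulnC.
  apply: leq_trans (card_class_points_le hn hk0 J0 hJ).
  rewrite mulnA -expnSr -expnMn leq_exp2r // card_class_points -sum_nat_const.
  by apply: leq_sum => u /(subsetP JP); rewrite inE.
have k00 : (0 < k0)%N.
  rewrite lt0n; apply: contraTneq hk0 => ->; case/andP: hn => n0 _.
  by rewrite -ltnNge mul0n expn_gt0 n0.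
have c0 : (0 < 16 * k0 ^ 3)%N by rewrite muln_gt0 expn_gt0 k00.
set t := (n ^ 2 %/ (16 * k0 ^ 3))%N.
case: (leqP #|P| t) => [Pt|tP].
  apply: bound => //; rewrite mulnC; apply: leq_trans (leq_trunc_div _ (16 * k0 ^ 3)).
  by rewrite leq_mul2r Pt orbT.
pose J := [set u in take t (enum P)].
have cJ : #|J| = t.
  rewrite cardsE (card_uniqP _) ?take_uniq ?enum_uniq // size_takel // -cardE.
  exact: ltnW.
have JP : J \subset P.
  by apply/subsetP => u; rewrite inE => /mem_take; rewrite mem_enum.
have := bound J JP; rewrite cJ mulnC leq_trunc_div => /(_ isT) h.
have t0 : (0 < t)%N by rewrite divn_gt0.
have := ltn_ceil (n ^ 2) c0; rewrite -/t => h2.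
have h3 : (n ^ 2 <= 32 * k0 ^ 3 * t)%N.
  by move: h2; rewrite mulSn; move: (k0 ^ 3)%N (n ^ 2)%N => x y; nia.
have h4 : (t * v ^ 3 <= t * (27 * 128 ^ 2 * (32 * k0 ^ 3)))%N.
  by apply: leq_trans h _; rewrite mulnCA leq_mul2l [(t * _)%N]mulnC h3 orbT.
have h5 : ((256 * k0) ^ 3 <= v ^ 3)%N by rewrite leq_exp2r.
rewrite leq_pmul2l // in h4.
have := leq_trans h5 h4; rewrite leqNgt => /negP[].
(* With [x = 128] this amounts to [27 * 32 = 864 < 1024 = 8 * 128]; a variable keeps the powers
   unexpanded. *)
have key x : (864 < 8 * x)%N -> (27 * x ^ 2 * (32 * k0 ^ 3) < (2 * x * k0) ^ 3)%N.
  move=> hx; have x0 : (0 < x)%N by case: x hx.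
  apply: (@leq_ltn_trans (x ^ 2 * (864 * k0 ^ 3))); first by apply: eq_leq; ring.
  apply: (@leq_trans (x ^ 2 * (8 * x * k0 ^ 3))); last by apply: eq_leq; ring.
  rewrite ltn_pmul2l; last by rewrite expn_gt0 x0.
  by rewrite ltn_pmul2r // expn_gt0 k00.
exact: (key 128%N isT).
Qed.
End Stepanov.

(** * Cauchy-Schwarz and collision counts *)

Lemma Cauchy_Schwarz_sum (R : numDomainType) (I : finType) (P : pred I) (w f g : I -> R) :
  (forall i, 0 <= w i) -> (forall i, f i \is Num.real) -> (forall i, g i \is Num.real) ->
  (\sum_(i | P i) w i * f i * g i) ^+ 2 <=
  (\sum_(i | P i) w i * f i ^+ 2) * (\sum_(i | P i) w i * g i ^+ 2).
Proof.
move=> hw hf hg; rewrite expr2 !big_distrlr /= -(ler_pMn2r (isT : (0 < 2)%N)) !mulr2n.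
rewrite [X in _ <= X + _]exchange_big /= -!big_split /=; apply: ler_sum => i _.
rewrite -!big_split /=; apply: ler_sum => j _.
have rx : f i * g j \is Num.real by rewrite rpredM.
have ry : f j * g i \is Num.real by rewrite rpredM.
rewrite -subr_ge0; have := real_exprn_even_ge0 (n := 2) (rpredB rx ry) isT.
move=> /(mulr_ge0 (mulr_ge0 (hw i) (hw j))); congr (0 <= _); ring.
Qed.

Lemma Cauchy_Schwarz_nat (I : finType) (P : pred I) (w f g : I -> nat) :
  ((\sum_(i | P i) w i * f i * g i) ^ 2 <=
   (\sum_(i | P i) w i * f i ^ 2) * (\sum_(i | P i) w i * g i ^ 2))%N.
Proof.
have := @Cauchy_Schwarz_sum int I P (fun i => (w i)%:R) (fun i => (f i)%:R)
  (fun i => (g i)%:R) (fun i => ler0n _ _) (fun i => realn _ _) (fun i => realn _ _).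
under [X in X ^+ 2 <= _]eq_bigr => i _ do rewrite /= -!natrM.
under [X in _ <= X * _]eq_bigr => i _ do rewrite /= -natrX -natrM.
under [X in _ <= _ * X]eq_bigr => i _ do rewrite /= -natrX -natrM.
by rewrite -!natr_sum -natrX -natrM ler_nat.
Qed.

Section Collisions.
Variables (X Y : finType) (P : {set X}) (h : X -> Y).

Definition collisions := #|[set xy : X * X | [&& xy.1 \in P, xy.2 \in P & h xy.1 == h xy.2]]|.

Definition multiplicity v := #|[set x in P | h x == v]|.

Lemma sum_multiplicity : (\sum_v multiplicity v = #|P|)%N.
Proof.
rewrite -sum1_card (partition_big h predT) //=; apply: eq_bigr => v _.
by rewrite /multiplicity -sum1_card; apply: eq_bigl => x; rewrite inE.
Qed.

Lemma collisionsE : (collisions = \sum_v multiplicity v ^ 2)%N.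
Proof.
rewrite /collisions -sum1_card (partition_big (fun xy : X * X => h xy.1) predT) //=.
apply: eq_bigr => v _; rewrite sum1_card -mulnn -cardsX; apply: eq_card => -[x y].
rewrite unfold_in !inE /= -!andbA; apply/and4P/and4P => [[-> -> /eqP-> /eqP->]|[-> /eqP-> -> /eqP->]] //.
Qed.

Lemma card_sqr_le_collisions : (#|P| ^ 2 <= #|h @: P| * collisions)%N.
Proof.
rewrite collisionsE -sum_multiplicity.
have supp v : v \notin h @: P -> multiplicity v = 0%N.
  move=> hv; apply/eqP; rewrite cards_eq0; apply/eqP/setP => x; rewrite !inE.
  by apply: contraNF hv => /andP[xP /eqP<-]; apply: imset_f.
have -> : (\sum_v multiplicity v = \sum_(v in h @: P) 1 * 1 * multiplicity v)%N.
  rewrite (bigID (mem (h @: P))) /= [X in (_ + X)%N]big1 ?addn0 //.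
  by apply: eq_bigr => v _; rewrite !mul1n.
apply: leq_trans (Cauchy_Schwarz_nat _ _ _ _) _.
rewrite sum1_card leq_mul2l; apply/orP; right.
under eq_bigr do rewrite mul1n.
by rewrite [X in (_ <= X)%N](bigID (mem (h @: P))) leq_addr.
Qed.
End Collisions.

(** * The third moment of the large fibers *)

Section Fibers.
Variables (F : finFieldType) (p n : nat).
Hypothesis n0 : (0 < n)%N.
Implicit Types (u : F * F) (x : F).

Lemma card_roots_le (c : F) : (#|[set x : F | x ^+ n == c]| <= n)%N.
Proof.
have h0 : ('X^n - c%:P : {poly F}) != 0 by rewrite -size_poly_gt0 size_XnsubC.
have := max_poly_roots h0 (rs := enum [set x : F | x ^+ n == c]) _ (enum_uniq _).
rewrite size_XnsubC // -cardE ltnS; apply.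
by apply/allP => x; rewrite mem_enum inE rootE !hornerE => /eqP ->; rewrite subrr.
Qed.

Lemma fiber_le u : (fiber n u <= n)%N.
Proof.
apply: leq_trans (card_roots_le u.1); apply: subset_leq_card; apply/subsetP => x.
by rewrite !inE => /and3P[_ _ /eqP<-].
Qed.

Lemma sum_power_class (G : F * F -> nat) :
  (\sum_(x : F | ((x != 0) && (x != 1))%R) G (power_class n x) = \sum_u fiber n u * G u)%N.
Proof.
rewrite (partition_big (@power_class F n) predT) //=; apply: eq_bigr => u _.
transitivity (\sum_(x in class_points n [set u]) G u)%N; last by rewrite sum_nat_const.
apply: eq_big => [x|x /andP[_ /eqP->] //]; by rewrite !inE andbA.
Qed.

Definition large_cubes t := (\sum_(u : F * F | t <= fiber n u) fiber n u ^ 3)%N.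

Hypothesis hF : char_ge F p.

(** Dyadic decomposition: by the count of popular classes each level [2^i <= fiber < 2^(i+1)]
    contributes [O(n^2)], and there are at most [trunc_log 2 n + 1] levels since a fiber has at most
    [n] points. The threshold [512 k0] ensures [2^i >= 256 k0]. *)
Lemma large_cubes_le k0 : (n <= p)%N -> (n ^ 2 <= k0 * p)%N -> (16 * k0 ^ 3 <= n ^ 2)%N ->
  (large_cubes (512 * k0) <= 8 * (27 * 128 ^ 2) * n ^ 2 * (trunc_log 2 n).+1)%N.
Proof.
move=> np hk0 h16; set l := (trunc_log 2 n).+1; have := fun v => card_popular hF (v := v) (introT andP (conj n0 np)) hk0 h16.
move: (27 * 128 ^ 2)%N => C pop.
pose c (i : 'I_l) u := ((256 * k0 <= 2 ^ i) && (2 ^ i <= fiber n u))%N.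
have k00 : (0 < k0)%N.
  by rewrite lt0n; apply: contraTneq hk0 => ->; rewrite -ltnNge mul0n expn_gt0 n0.
apply: (@leq_trans (\sum_u \sum_(i < l) c i u * (8 * (2 ^ i) ^ 3))).
  rewrite [X in (_ <= X)%N](bigID (fun u => 512 * k0 <= fiber n u))%N /=.
  apply: leq_trans (leq_addr _ _); apply: leq_sum => u hu.
  have f0 : (0 < fiber n u)%N by apply: leq_trans hu; rewrite muln_gt0.
  have /andP[le1 le2] := trunc_log_bounds (isT : 1 < 2)%N f0.
  set i := trunc_log 2 _ in le1 le2.
  have il : (i < l)%N by rewrite ltnS; apply: leq_trunc_log; apply: fiber_le.
  rewrite (bigD1 (Ordinal il)) //=; apply: leq_trans (leq_addr _ _).
  have -> : c (Ordinal il) u.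
    rewrite /c /= le1 andbT -(leq_pmul2l (isT : 0 < 2)%N) -expnS.
    apply: leq_trans (ltnW le2); apply: leq_trans hu.
    by rewrite mulnA.
  by rewrite mul1n (_ : 8 = 2 ^ 3)%N // -expnMn -expnS leq_exp2r // ltnW.
rewrite exchange_big /= mulnC.
apply: (@leq_trans (\sum_(i < l) 8 * C * n ^ 2)); last first.
  by rewrite sum_nat_const card_ord.
apply: leq_sum => i _; rewrite -big_distrl /= mulnCA -!mulnA leq_mul2l /=.
case: (leqP (256 * k0) (2 ^ i)) => hi; last first.
  by rewrite big1 // => u _; rewrite /c leqNgt hi.
rewrite (eq_bigr (fun u => nat_of_bool (u \in [set u | 2 ^ i <= fiber n u])%N)); last first.
  by move=> u _; rewrite /c hi inE.
by rewrite -big_mkcond /= sum1_card; apply: pop hi.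
Qed.
End Fibers.

(** * Additive and shifted multiplicative energies through the fibers *)

Section Energies.
Variables (F : finFieldType) (n : nat).
Hypothesis n0 : (0 < n)%N.

Definition roots_of_unity : {set F} := [set x | x ^+ n == 1].
Local Notation A := roots_of_unity.

(** Equal differences count the same quadruples as equal sums, and the Fourier transform of the
    difference multiplicity is [|fourier_set|^2]. *)
Definition additive_energy := collisions (setX A A) (fun ab : F * F => ab.1 - ab.2).

Lemma roots_neq0 x : x \in A -> x != 0.
Proof. by rewrite inE; apply: contraTneq => ->; rewrite expr0n eqn0Ngt n0 eq_sym oner_eq0. Qed.

Lemma card_roots : (#|A| <= n)%N.
Proof. exact: card_roots_le. Qed.

(** If [a - b = s], then [x = a / s] satisfies [x - 1 = b / s], so both [n]-th powers equal
    [s^(-n)]. *)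
Lemma diff_multiplicity_le s : s != 0 ->
  (multiplicity (setX A A) (fun ab => ab.1 - ab.2)%R s <=
   fiber n ((s ^+ n)^-1, (s ^+ n)^-1))%N.
Proof.
move=> s0; rewrite /multiplicity /fiber.
rewrite -(card_in_imset (f := fun ab : F * F => ab.1 / s)); last first.
  move=> [a b] [c d]; rewrite !inE /= => /andP[_ /eqP h1] /andP[_ /eqP h2].
  move=> /(mulIf (invr_neq0 s0)) ac; rewrite -ac in h2 *.
  by congr pair; apply: oppr_inj; apply: (addrI a); rewrite h1 h2.
apply: subset_leq_card; apply/subsetP => _ /imsetP[[a b] + ->].
rewrite inE in_setX /= -andbA => /and3P[aA bA /eqP abs].
have E : a / s - 1 = b / s.
  by apply: (mulIf s0); rewrite mulrBl !divfK // mul1r -abs opprB addrC subrK.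
rewrite inE inE /power_class E !expr_div_n.
move: (aA) (bA); rewrite !inE => /eqP-> /eqP->; rewrite !mul1r eqxx andbT.
rewrite mulf_neq0 ?invr_neq0 ?(roots_neq0 aA) //=.
by rewrite -subr_eq0 E mulf_neq0 ?invr_neq0 ?(roots_neq0 bA).
Qed.

(** Trivial bound for the exceptional values, difference 0 and ratio 1, where one coordinate
    determines the pair. *)
Lemma multiplicity0_le (X Y : finType) (P : {set X}) (h : X -> Y) (k : X -> F) v :
  {in [set x in P | h x == v] &, injective k} -> {in P, forall x, k x \in A} ->
  (multiplicity P h v <= n)%N.
Proof.
move=> kI kA; rewrite /multiplicity -(card_in_imset kI); apply: leq_trans card_roots.
apply: subset_leq_card; apply/subsetP => _ /imsetP[x + ->].
by rewrite inE => /andP[/kA].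
Qed.

(** If [x^n = (x - 1)^n], then [(x - 1) / x = 1 - 1 / x] is a root of unity, and it determines
    [x]. *)
Lemma sum_diag_fiber : (\sum_(g : F) fiber n (g, g) <= n)%N.
Proof.
rewrite /fiber.
apply: (@leq_trans #|[set x : F | (x != 0) && (x ^+ n == (x - 1) ^+ n)]|).
  rewrite -[X in (_ <= X)%N]sum1_card.
  rewrite [X in (_ <= X)%N](partition_big (fun x : F => x ^+ n) predT) //=.
  apply: leq_sum => g _; rewrite sum1_card; apply: subset_leq_card; apply/subsetP => x.
  rewrite !inE => /and3P[x0 _ /eqP[h1 h2]].
  by rewrite unfold_in !inE x0 h1 h2 !eqxx.
rewrite -(card_in_imset (f := fun x : F => (x - 1) / x)); last first.
  move=> x y; rewrite !inE => /andP[x0 _] /andP[y0 _].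
  rewrite !mulrBl !divff // !mul1r => /addrI/oppr_inj/invr_inj //.
apply: leq_trans card_roots; apply: subset_leq_card; apply/subsetP => _ /imsetP[x + ->].
by rewrite !inE => /andP[x0 /eqP h]; rewrite expr_div_n -h divff // expf_neq0.
Qed.

(** Where [y < t], one factor of [r^2] is replaced by [t]; elsewhere [r] is replaced by [y]. *)
Lemma sum_split_at (I : finType) (P : pred I) (r y : I -> nat) t :
  (forall i, P i -> r i <= y i)%N ->
  (\sum_(i | P i) r i ^ 2 <= t * (\sum_(i | P i) r i) + \sum_(i | P i && (t <= y i)) y i ^ 2)%N.
Proof.
move=> ry; rewrite big_distrr /= [X in (_ <= _ + X)%N]big_mkcondr -big_split /=.
apply: leq_sum => i Pi; case: (leqP t (y i)) => [ty|yt].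
  by apply: leq_trans (leq_addl _ _); rewrite leq_exp2r // ry.
by rewrite addn0 -mulnn leq_mul2r ltnW ?orbT // (leq_ltn_trans _ yt) // ry.
Qed.

Lemma leq_sum_inj (I J : finType) (D : {set I}) (d : I -> J) (Q : pred J) (G : J -> nat) :
  {in D &, injective d} ->
  (\sum_(i | (i \in D) && Q (d i)) G (d i) <= \sum_(j | Q j) G j)%N.
Proof.
move=> dI; rewrite big_mkcondr -(big_imset (fun j => if Q j then G j else 0%N) dI) /=.
rewrite [X in (_ <= X)%N]big_mkcond /= [X in (_ <= X)%N](bigID (mem (d @: D))) /=.
exact: leq_addr.
Qed.

(** The three terms come from difference 0, from small fibers and from large ones, where at most [n]
    values of [s] share a class. Then [m], a sum of squares over diagonal classes, is interpolated
    by Cauchy-Schwarz between the first moment, at most [n], and the third. *)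
Lemma additive_energy_le t : exists2 m : nat,
  (additive_energy <= n ^ 2 + t * n ^ 2 + n * m)%N & (m ^ 2 <= n * large_cubes F n t)%N.
Proof.
pose d g : F * F := (g, g).
pose m := (\sum_(g : F | t <= fiber n (d g)) fiber n (d g) ^ 2)%N.
exists m; last first.
  have := Cauchy_Schwarz_nat (fun g => t <= fiber n (d g))%N
    (fun g => fiber n (d g)) (fun g => 1%N) (fun g => fiber n (d g)).
  under eq_bigr do rewrite muln1 mulnn.
  move/leq_trans; apply; apply: leq_mul.
    under eq_bigr do rewrite muln1.
    apply: leq_trans sum_diag_fiber.
    by rewrite [X in (_ <= X)%N](bigID (fun g => t <= fiber n (d g)))%N leq_addr.
  rewrite /large_cubes.
  under eq_bigr do rewrite -expnS.
  apply: leq_trans (leq_sum_inj (D := setT) (d := d) (fun u => t <= fiber n u)%N _ _).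
    by apply/eq_leq/eq_bigl => g; rewrite inE.
  by move=> g h _ _ [].
rewrite /additive_energy collisionsE (bigD1 0) //= -addnA leq_add //.
  rewrite leq_exp2r //; apply: (@multiplicity0_le _ _ _ _ (fun ab => ab.1)).
    move=> [a b] [a' b']; rewrite !inE /= !subr_eq0 => /andP[_ /eqP->] /andP[_ /eqP->].
    by move=> ->.
  by move=> [a b]; rewrite in_setX => /andP[].
apply: leq_trans (sum_split_at t diff_multiplicity_le) _; apply: leq_add.
  rewrite leq_mul2l; apply/orP; right.
  apply: (@leq_trans #|setX A A|).
    by rewrite -(sum_multiplicity _ (fun ab : F * F => ab.1 - ab.2)) [X in (_ <= X)%N](bigD1 0) //= leq_addl.
  by rewrite cardsX -mulnn leq_mul // card_roots.
rewrite (partition_big (fun s : F => (s ^+ n)^-1) (fun g => t <= fiber n (d g))%N) /=; last first.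
  by move=> s /andP[].
rewrite /m big_distrr /=; apply: leq_sum => g _.
apply: (@leq_trans (\sum_(s in [set s : F | s ^+ n == g^-1]) fiber n (d g) ^ 2)).
  rewrite [X in (_ <= X)%N]big_mkcond [X in (X <= _)%N]big_mkcond /=; apply: leq_sum => s _.
  by case: ifP => // /andP[_ /eqP <-]; rewrite inE invrK eqxx.
by rewrite sum_nat_const leq_mul2r card_roots_le // orbT.
Qed.

Definition shift_product (ab : F * F) := (ab.1 + 1) * (ab.2 + 1).

Definition shift_ratio (ac : F * F) := (ac.1 + 1) / (ac.2 + 1).
Local Notation A' := (A :\ (-1)%R).

Lemma in_rootsD1 a : (a \in A') = (a + 1 != 0) && (a \in A).
Proof. by rewrite in_setD1 -addr_eq0. Qed.

(** [(a + 1)(b + 1) = (c + 1)(d + 1)] becomes [(a + 1) / (c + 1) = (d + 1) / (b + 1)]; without [-1]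
    the divisions are legitimate. *)
Lemma shift_collisions :
  (collisions (setX A' A') shift_product <= collisions (setX A' A') shift_ratio)%N.
Proof.
pose k (x : (F * F) * (F * F)) := ((x.1.1, x.2.1), (x.2.2, x.1.2)).
rewrite /collisions -(card_imset _ (f := k)); last by move=> [[? ?] [? ?]] [[? ?] [? ?]] [-> -> -> ->].
apply: subset_leq_card; apply/subsetP => _ /imsetP[[[a b] [c d]] + ->].
rewrite inE [in X in _ -> X]inE /k /= !in_setX /= !in_rootsD1.
move=> /and3P[/andP[/andP[-> ->] /andP[b1 ->]] /andP[/andP[c1 ->] /andP[-> ->]] /eqP h].
by rewrite b1 c1 /= /shift_ratio /= eqr_div // -[X in X == _]/(shift_product (a, b)) h /shift_product /= mulrC.
Qed.

Lemma in_shift_ratio_fiber v a c : (a, c) \in [set x in setX A' A' | shift_ratio x == v] ->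
  [/\ a + 1 != 0, a \in A, c \in A & a + 1 = v * (c + 1)].
Proof.
rewrite inE in_setX /= !in_rootsD1 => /andP[/andP[/andP[-> ->] /andP[c1 ->]] /eqP <-].
by rewrite divfK.
Qed.

(* If a + 1 = v (c + 1), then x = a / (v - 1) satisfies x - 1 = v c / (v - 1): the
   pairs (a, c) of ratio v are points of the class dual to that of v. *)
Definition dual_class (u : F * F) : F * F := (u.2^-1, u.1 / u.2).

Lemma ratio_multiplicity_le v : (v != 1) && (v != 0) ->
  (multiplicity (setX A' A') shift_ratio v <= fiber n (dual_class (power_class n v)))%N.
Proof.
move=> /andP[v1 v0]; have w0 : v - 1 != 0 by rewrite subr_eq0.
rewrite /multiplicity /fiber.
rewrite -(card_in_imset (f := fun ac : F * F => ac.1 / (v - 1))); last first.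
  move=> [a b] [c d] /in_shift_ratio_fiber[_ _ _ h1] /in_shift_ratio_fiber[_ _ _ h2] /=.
  move=> /(mulIf (invr_neq0 w0)) ac; rewrite -ac in h2 *.
  by congr pair; apply: (addIr 1); apply: (mulfI v0); rewrite -h1.
apply: subset_leq_card; apply/subsetP => _ /imsetP[[a c] /in_shift_ratio_fiber[_ aA cA h] ->].
rewrite /=.
have E : a / (v - 1) - 1 = v * c / (v - 1).
  apply: (mulIf w0); rewrite mulrBl !divfK // mul1r.
  by rewrite opprB addrA h mulrDr mulr1 addrK.
rewrite inE inE /power_class E /dual_class /= !expr_div_n exprMn.
move: (aA) (cA); rewrite !inE => /eqP-> /eqP->; rewrite !mulr1 mul1r eqxx andbT.
rewrite mulf_neq0 ?invr_neq0 ?(roots_neq0 aA) //=.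
by rewrite -subr_eq0 E !mulf_neq0 ?invr_neq0 ?(roots_neq0 cA).
Qed.

Lemma fiber_eq0 (u : F * F) : ~~ ((u.1 != 0) && (u.2 != 0)) -> fiber n u = 0%N.
Proof.
move=> hu; apply/eqP; rewrite cards_eq0; apply/eqP/setP => x; rewrite !inE.
apply: contraNF hu => /and3P[x0 x1 /eqP <-] /=.
by rewrite !expf_neq0 // subr_eq0.
Qed.

(** Grouping [v] by class gives terms [fiber u * fiber (dual u)^2], each at most the cube of the
    larger factor. Duality is injective on pairs of nonzero entries, so each kind of cube sums to at
    most [large_cubes]. *)
Lemma sum_dual_class_le t :
  (\sum_(v : F | ((v != 1) && (v != 0))%R && (t <= fiber n (dual_class (power_class n v))))
     fiber n (dual_class (power_class n v)) ^ 2 <= 2 * large_cubes F n t)%N.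
Proof.
pose G u := (if t <= fiber n (dual_class u) then fiber n (dual_class u) ^ 2 else 0)%N.
have -> : (\sum_(v : F | ((v != 1) && (v != 0))%R && (t <= fiber n (dual_class (power_class n v))))
     fiber n (dual_class (power_class n v)) ^ 2 = \sum_u fiber n u * G u)%N.
  by rewrite -sum_power_class big_mkcondr; apply: eq_bigl => v; rewrite andbC.
pose D : {set F * F} := [set u | (u.1 != 0) && (u.2 != 0)].
have dI : {in D &, injective dual_class}.
  move=> [a b] [c d]; rewrite !inE /= => /andP[a0 b0] /andP[c0 d0] [/invr_inj <-].
  by move=> /(mulIf (invr_neq0 b0)) ->.
rewrite (bigID (mem D)) /= [X in (_ + X)%N]big1 ?addn0; last first.
  by move=> u; rewrite inE => /fiber_eq0 ->.
rewrite mul2n -addnn.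
have h1 := leq_sum_inj (fun u => t <= fiber n u)%N (fun u => fiber n u ^ 3)%N dI.
have h2 := @leq_sum_inj _ _ D id (fun u => t <= fiber n u)%N (fun u => fiber n u ^ 3)%N (in2W (@inj_id _)).
apply: leq_trans (leq_add h1 h2); rewrite !big_mkcondr -big_split /=.
apply: leq_sum => u _; rewrite /G; case: ifP => [ty|]; last by rewrite muln0.
case: (leqP (fiber n u) (fiber n (dual_class u))) => [le|lt].
  by apply: leq_trans (leq_addr _ _); rewrite [X in (_ <= X)%N]expnS leq_mul2r le orbT.
rewrite (leq_trans ty (ltnW lt)); apply: leq_trans (leq_addl _ _).
by rewrite [X in (_ <= X)%N]expnS leq_mul2l leq_exp2r // (ltnW lt) orbT.
Qed.

Lemma shift_energy_le t :
  (collisions (setX A' A') shift_product <= n ^ 2 + t * n ^ 2 + 2 * large_cubes F n t)%N.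
Proof.
apply: leq_trans shift_collisions _; rewrite collisionsE (bigD1 1) //= -addnA leq_add //.
  rewrite leq_exp2r //; apply: (@multiplicity0_le _ _ _ _ (fun ac => ac.1)).
    move=> [a b] [c d] /in_shift_ratio_fiber[_ _ _ + ] /in_shift_ratio_fiber[_ _ _ +] /= ac.
    by rewrite !mul1r ac => /addIr-> /addIr->.
  by move=> [a b]; rewrite in_setX !in_rootsD1 => /andP[/andP[]].
have m0 : multiplicity (setX A' A') shift_ratio 0 = 0%N.
  apply/eqP; rewrite cards_eq0; apply/eqP/setP => -[a c]; rewrite [RHS]inE.
  apply/negP => /in_shift_ratio_fiber[+ _ _].
  by rewrite mul0r => /eqP.
rewrite (bigD1 0) ?m0 ?(eq_sym 0) ?oner_eq0 //= add0n.
apply: leq_trans (sum_split_at t ratio_multiplicity_le) _; apply: leq_add; last first.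
  exact: sum_dual_class_le.
rewrite leq_mul2l; apply/orP; right.
apply: (@leq_trans #|setX A' A'|).
  rewrite -(sum_multiplicity _ shift_ratio) [X in (_ <= X)%N](bigID (fun v => (v != 1) && (v != 0))) /=.
  exact: leq_addr.
by rewrite cardsX -mulnn leq_mul // (leq_trans _ card_roots) // subset_leq_card // subD1set.
Qed.
End Energies.

(** * Fourier analysis on a finite field *)

Section Fourier.
Variables (F : finFieldType) (e : F -> algC).
Hypothesis eD : forall x y, e (x + y) = e x * e y.
Hypothesis e_norm : forall x, `|e x| = 1.
Hypothesis e_sum : \sum_x e x = 0.

Definition fourier (f : F -> algC) xi := \sum_x f x * e (xi * x).
Definition fourier_set (B : {set F}) xi := \sum_(x in B) e (xi * x).

Local Notation q := (#|F|%:R : algC).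

Lemma character0 : e 0 = 1.
Proof.
have e0 : e 0 != 0 by rewrite -normr_eq0 e_norm oner_eq0.
by apply: (mulfI e0); rewrite -eD addr0 mulr1.
Qed.

Lemma character_conj x : (e x)^* = e (- x).
Proof.
have ex0 : e x != 0 by rewrite -normr_eq0 e_norm oner_eq0.
apply: (mulfI ex0); rewrite -normCK e_norm expr1n -eD subrr character0 //.
Qed.

Lemma character_orthogonality x : \sum_xi e (xi * x) = q * (x == 0)%:R.
Proof.
have [->|x0] := eqVneq x 0.
  by under eq_bigr do rewrite mulr0 character0; rewrite sumr_const mulr1.
rewrite mulr0 -[RHS]e_sum [RHS](reindex (fun xi => xi * x)) //=.
by exists (fun y => y / x) => y _; rewrite ?mulfK ?divfK.
Qed.

Lemma fourier_setE B : fourier_set B =1 fourier (fun x => (x \in B)%:R).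
Proof.
move=> xi; rewrite /fourier_set big_mkcond /=; apply: eq_bigr => x _.
by case: (x \in B); rewrite ?mul1r ?mul0r.
Qed.

Lemma Parseval f : \sum_xi `|fourier f xi| ^+ 2 = q * \sum_x `|f x| ^+ 2.
Proof.
transitivity (\sum_x \sum_y f x * (f y)^* * \sum_xi e (xi * (x - y))).
  under eq_bigr => xi _.
    rewrite normCK rmorph_sum big_distrlr /=.
    under eq_bigr => x _ do under eq_bigr => y _ do
      rewrite rmorphM /= character_conj -mulrN mulrACA -eD -mulrDr.
    over.
  rewrite exchange_big; apply: eq_bigr => x _; rewrite exchange_big; apply: eq_bigr => y _.
  by rewrite mulr_sumr.
rewrite mulr_sumr; apply: eq_bigr => x _; rewrite (bigD1 x) //= [X in _ + X]big1 ?addr0.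
  by rewrite subrr character_orthogonality eqxx mulr1 -normCK mulrC.
by move=> y yx; rewrite character_orthogonality subr_eq0 eq_sym (negPf yx) !mulr0.
Qed.

Lemma Parseval_set B : \sum_xi `|fourier_set B xi| ^+ 2 = q * #|B|%:R.
Proof.
under eq_bigr do rewrite fourier_setE.
rewrite Parseval -sum1_card natr_sum [in RHS]big_mkcond /=; congr (_ * _).
by apply: eq_bigr => x _; case: (x \in B); rewrite ?normr1 ?normr0 ?expr1n ?expr0n.
Qed.

(** As [b + c = a] has no solution, the frequency 0 term [#|B| #|C| #|A|] is cancelled by the
    others. Those are bounded by [Q] on the coefficients of [A], and by Cauchy-Schwarz with Parseval
    on those of [B] and [C]. *)
Lemma sumset_gap (A B C : {set F}) (Q : algC) :
  (forall xi, xi != 0 -> `|fourier_set A xi| ^+ 2 <= Q) ->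
  (forall b c, b \in B -> c \in C -> b + c \notin A) ->
  (#|B| * #|C| * #|A| ^ 2)%:R <= Q * q ^+ 2.
Proof.
move=> hQ gap.
have Q0 : 0 <= Q by apply: le_trans (hQ 1 (oner_neq0 _)); rewrite exprn_ge0.
have [|BC0] := posnP (#|B| * #|C|)%N.
  by move=> ->; rewrite mul0n mulr_ge0 ?exprn_ge0.
have total : \sum_xi fourier_set B xi * fourier_set C xi * fourier_set A (- xi) = 0.
  transitivity (\sum_(b in B) \sum_(c in C) \sum_(a in A) \sum_xi e (xi * (b + c - a))).
    under eq_bigr => xi _.
      rewrite big_distrlr mulr_suml /=.
      under eq_bigr => b _.
        rewrite mulr_suml; under eq_bigr => c _.
          rewrite mulr_sumr; under eq_bigr => a _.
            rewrite -!eD mulNr -mulrN -!mulrDr; over.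
          over.
        over.
      over.
    rewrite exchange_big; apply: eq_bigr => b _; rewrite exchange_big.
    by apply: eq_bigr => c _; rewrite exchange_big.
  rewrite big1 // => b bB; rewrite big1 // => c cC; rewrite big1 // => a aA.
  rewrite character_orthogonality subr_eq0; case: eqP => [E|]; last by rewrite mulr0.
  by have := gap b c bB cC; rewrite E aA.
have main : (#|B| * #|C| * #|A|)%:R <=
    \sum_(xi | xi != 0) 1 * (`|fourier_set B xi| * `|fourier_set A (- xi)|) * `|fourier_set C xi|.
  move: total; rewrite (bigD1 0) //= => /eqP; rewrite addr_eq0 => /eqP h.
  have f0 D : fourier_set D 0 = #|D|%:R.
    by rewrite /fourier_set; under eq_bigr do rewrite mul0r character0; rewrite sumr_const.
  rewrite oppr0 !f0 -!natrM in h; rewrite -[_%:R]ger0_norm ?ler0n // h normrN.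
  apply: le_trans (ler_norm_sum _ _ _) _; apply: ler_sum => xi _.
  by rewrite !normrM mul1r mulrAC.
have CS := @Cauchy_Schwarz_sum algC F (fun xi => xi != 0) (fun=> 1)
  (fun xi => `|fourier_set B xi| * `|fourier_set A (- xi)|) (fun xi => `|fourier_set C xi|)
  (fun=> ler01) (fun=> rpredM (normr_real _) (normr_real _)) (fun=> normr_real _).
have le_all D : \sum_(xi | xi != 0) `|fourier_set D xi| ^+ 2 <= q * #|D|%:R.
  rewrite -Parseval_set [X in _ <= X](bigD1 0) //= lerDr.
  by rewrite exprn_ge0.
have : (#|B| * #|C| * #|A|)%:R ^+ 2 <= (Q * (q * #|B|%:R)) * (q * #|C|%:R).
  apply: le_trans (_ : _ <= _) _; last apply: le_trans CS _.
    by rewrite ler_pXn2r // nnegrE ?ler0n // sumr_ge0 // => xi _; rewrite mul1r !mulr_ge0.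
  apply: ler_pM.
  - by apply: sumr_ge0 => xi _; rewrite mul1r exprn_ge0 // mulr_ge0.
  - by apply: sumr_ge0 => xi _; rewrite mul1r exprn_ge0.
  - apply: le_trans (_ : _ <= Q * \sum_(xi | xi != 0) `|fourier_set B xi| ^+ 2) _; last first.
      by rewrite ler_wpM2l.
    rewrite mulr_sumr; apply: ler_sum => xi xi0; rewrite mul1r exprMn mulrC.
    by apply: ler_wpM2r; rewrite ?exprn_ge0 // hQ // oppr_eq0.
  - by under eq_bigr do rewrite mul1r; apply: le_all.
have BC0' : 0 < (#|B| * #|C|)%:R :> algC by rewrite ltr0n.
move=> h; rewrite -(ler_pM2l BC0'); apply: le_trans (_ : _ <= _) _; last apply: le_trans h _.
  by rewrite -natrX -natrM ler_nat eq_leq //; ring.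
by rewrite natrM le_eqVlt; apply/orP; left; apply/eqP; ring.
Qed.

(** * Fourier coefficients of multiplicatively closed sets *)

Section Invariant.
Variable A : {set F}.
Hypothesis A0 : forall x, x \in A -> x != 0.
Hypothesis AM : forall x y, x \in A -> y \in A -> x * y \in A.
Hypothesis A_gt0 : (0 < #|A|)%N.

Let r s : algC := (multiplicity (setX A A) (fun ab : F * F => ab.1 - ab.2) s)%:R.

Lemma mul_invariant c : c \in A -> [set c * x | x in A] = A.
Proof.
move=> cA; apply/eqP; rewrite eqEcard; apply/andP; split.
  by apply/subsetP => _ /imsetP[x xA ->]; apply: AM.
by rewrite card_imset //; apply: mulfI; apply: A0.
Qed.

Lemma fourier_set_invariant c xi : c \in A -> fourier_set A (c * xi) = fourier_set A xi.
Proof.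
move=> cA; rewrite /fourier_set -[in RHS](mul_invariant cA) big_imset /=.
  by apply: eq_bigr => x _; rewrite mulrCA mulrA.
by move=> x y _ _; apply: mulfI; apply: A0.
Qed.

Lemma fourier_difference xi : fourier r xi = `|fourier_set A xi| ^+ 2.
Proof.
rewrite normCK /fourier_set rmorph_sum big_distrlr /= pair_big_dep /=.
rewrite (partition_big (fun ab : F * F => ab.1 - ab.2) predT) //=.
apply: eq_bigr => s _; rewrite /r /multiplicity -sum1_card natr_sum mulr_suml.
apply: eq_big => [[a b]|[a b]]; first by rewrite !inE /= .
rewrite !inE /= => /andP[_ /eqP <-].
by rewrite mul1r character_conj -mulrN -eD -mulrDr.
Qed.

Lemma sum_difference : \sum_s r s = #|A|%:R ^+ 2.
Proof. by rewrite -natr_sum sum_multiplicity cardsX natrM expr2. Qed.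

Lemma sum_difference_sqr : \sum_s r s ^+ 2 = (collisions (setX A A) (fun ab : F * F => ab.1 - ab.2))%:R.
Proof. by rewrite collisionsE natr_sum; apply: eq_bigr => s _; rewrite natrX. Qed.

(** The [#|A|] frequencies [c * xi] with [c] in [A] carry the same coefficient, and Parseval bounds
    their total by [q #|A|]. *)
Lemma fourier_set_le_card xi : xi != 0 -> `|fourier_set A xi| ^+ 2 <= q.
Proof.
move=> xi0; have n0 : 0 < #|A|%:R :> algC by rewrite ltr0n.
rewrite -(ler_pM2r n0) -Parseval_set mulr_natr -sumr_const.
rewrite (eq_bigr (fun c => `|fourier_set A (c * xi)| ^+ 2)); last first.
  by move=> c cA; rewrite fourier_set_invariant.
rewrite -(big_imset (fun x => `|fourier_set A x| ^+ 2) (h := fun c => c * xi)) /=; last first.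
  by move=> x y _ _; apply: mulIf.
rewrite [X in _ <= X](bigID (mem [set c * xi | c in A])) /= lerDl.
by apply: sumr_ge0 => x _; rewrite exprn_ge0.
Qed.

(** Two applications of Cauchy-Schwarz to [#|A| Q = sum_s r(s) fourier_set A (xi s)]: the first uses
    that [r] has sum [#|A|^2], the second that [r^2] has sum [E]. *)
Lemma fourier_set_le_energy xi : xi != 0 ->
  (`|fourier_set A xi| ^+ 2) ^+ 4 <=
  q * (collisions (setX A A) (fun ab : F * F => ab.1 - ab.2))%:R ^+ 2.
Proof.
move=> xi0; set Q := _ ^+ 2; set E := (collisions _ _)%:R.
have n0 : 0 < #|A|%:R :> algC by rewrite ltr0n.
have Q0 : 0 <= Q by rewrite exprn_ge0.
have r0 s : 0 <= r s by apply: ler0n.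
have rR s : r s \is Num.real by apply: ger0_real.
have h1 : #|A|%:R * Q <= \sum_s r s * 1 * `|fourier_set A (xi * s)|.
  rewrite -[X in X <= _]ger0_norm ?mulr_ge0 ?ler0n //.
  (* Averaging over the dilates [c * xi] with [c] in [A], at which the coefficient is unchanged. *)
  have -> : #|A|%:R * Q = \sum_s r s * fourier_set A (xi * s).
    rewrite mulr_natl -sumr_const.
    rewrite (eq_bigr (fun c => fourier r (c * xi))); last first.
      by move=> c cA; rewrite fourier_difference fourier_set_invariant.
    rewrite exchange_big; apply: eq_bigr => s _; rewrite -mulr_sumr; congr (_ * _).
    by apply: eq_bigr => c _; rewrite -mulrA mulrC.
  apply: le_trans (ler_norm_sum _ _ _) _; apply: ler_sum => s _.
  by rewrite normrM mulr1 (ger0_norm (r0 s)).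
have h2 : Q ^+ 2 <= \sum_s 1 * r s * `|fourier_set A (xi * s)| ^+ 2.
  have CS := @Cauchy_Schwarz_sum algC F predT r (fun=> 1) (fun s => `|fourier_set A (xi * s)|)
    r0 (fun=> real1 _) (fun=> normr_real _).
  have n2 : 0 < #|A|%:R ^+ 2 :> algC by rewrite exprn_gt0.
  rewrite -(ler_pM2l n2) -exprMn; apply: le_trans (_ : _ <= _) _; last apply: le_trans CS _.
    by rewrite ler_pXn2r // nnegrE ?mulr_ge0 // ?ler0n // sumr_ge0 // => s _; rewrite mulr1 mulr_ge0.
  under eq_bigr do rewrite expr1n mulr1.
  by rewrite sum_difference; under [X in _ <= _ * X]eq_bigr do rewrite mul1r.
have CS := @Cauchy_Schwarz_sum algC F predT (fun=> 1) r (fun s => `|fourier_set A (xi * s)| ^+ 2)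
  (fun=> ler01) rR (fun s => rpredX 2 (normr_real _)).
rewrite (exprM Q 2 2); apply: le_trans (_ : _ <= _) _; last apply: le_trans CS _.
  by rewrite ler_pXn2r // nnegrE ?exprn_ge0 // sumr_ge0 // => s _; rewrite mul1r mulr_ge0 ?exprn_ge0.
under eq_bigr do rewrite mul1r.
rewrite sum_difference_sqr -/E.
have -> : \sum_s 1 * (`|fourier_set A (xi * s)| ^+ 2) ^+ 2 = q * E.
  under eq_bigr do rewrite mul1r.
  rewrite /E -sum_difference_sqr.
  (* The fourth moment of [fourier_set A] is the second moment of [fourier r], to which Parseval
     applies. *)
  transitivity (\sum_s `|fourier r s| ^+ 2).
    rewrite [RHS](reindex (fun s => xi * s)) /=.
      by apply: eq_bigr => s _; rewrite fourier_difference [in RHS]ger0_norm // exprn_ge0.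
    by exists (fun s => xi^-1 * s) => s _; rewrite ?mulKf ?mulVKf.
  by rewrite Parseval; congr (_ * _); apply: eq_bigr => s _; rewrite ger0_norm.
by rewrite mulrCA expr2.
Qed.
End Invariant.
End Fourier.

(** * Iterated sumsets *)

Section Sumsets.
Variables (F : finFieldType) (A : {set F}).

Lemma mem_sumset k (f : 'I_k -> F) : (forall i, f i \in A) -> \sum_i f i \in sumset k A.
Proof.
move=> fA; apply/imsetP; exists [ffun i => f i]; first by apply/ffun_onP => i; rewrite ffunE fA.
by apply: eq_bigr => i _; rewrite ffunE.
Qed.

Lemma sumsetD j k x y : x \in sumset j A -> y \in sumset k A -> x + y \in sumset (j + k) A.
Proof.
move=> /imsetP[f /ffun_onP fA ->] /imsetP[g /ffun_onP gA ->].
pose h i := match split i with inl u => f u | inr v => g v end.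
have -> : \sum_i f i + \sum_i g i = \sum_i h i.
  rewrite big_split_ord /h; congr (_ + _); apply: eq_bigr => i _.
    by rewrite -[lshift _ _]/(unsplit (inl i)) unsplitK.
  by rewrite -[rshift _ _]/(unsplit (inr i)) unsplitK.
by apply: mem_sumset => i; rewrite /h; case: split.
Qed.

Lemma sumset1 x : x \in A -> x \in sumset 1 A.
Proof.
move=> xA; have := @mem_sumset 1 (fun=> x) (fun=> xA).
by rewrite big_ord_recl big_ord0 addr0.
Qed.

Lemma sumsetM k c x : (forall y, y \in A -> c * y \in A) -> x \in sumset k A -> c * x \in sumset k A.
Proof.
move=> cA /imsetP[f /ffun_onP fA ->]; rewrite mulr_sumr.
by apply: mem_sumset => i; apply: cA; apply: fA.
Qed.
End Sumsets.

(** * Additive characters and subgroups of units of the prime field *)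

Lemma char_ge_Fp p : prime p -> char_ge 'F_p p.
Proof.
move=> pp k /andP[k0 kp]; rewrite -(dvdn_pcharf (pchar_Fp pp)).
by rewrite gtnNdvd.
Qed.

Lemma exists_character p : prime p ->
  exists e : 'F_p -> algC, [/\ forall x y, e (x + y) = e x * e y,
    forall x, `|e x| = 1 & \sum_x e x = 0].
Proof.
move=> pp; have [z hz] := C_prim_root_exists (prime_gt0 pp).
have zp : z ^+ p = 1 := prim_expr_order hz.
(* [x] is read as its natural representative; reduction modulo [p] is harmless because [z^p = 1]. *)
exists (fun x => z ^+ x); split.
- move=> x y; rewrite -exprD /= -[RHS](prim_expr_mod hz).
  by rewrite {3}Fp_cast.
- move=> x; rewrite normrX; suff -> : `|z| = 1 by rewrite expr1n.
  by apply/eqP; rewrite -(pexpr_eq1 (prime_gt0 pp)) // -normrX zp normr1.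
- have z1 : z - 1 != 0.
    rewrite subr_eq0; apply/eqP => z1; have := prim_order_dvd hz 1.
    by rewrite z1 expr1n eqxx dvdn1 => /eqP E; rewrite E in pp.
  apply: (mulfI z1); rewrite mulr0.
  have h : (z - 1) * (\sum_(i < p) z ^+ i) = 0 by rewrite -subrX1 zp subrr.
  by rewrite -[RHS]h -[in RHS](Fp_cast pp).
Qed.

(** Lagrange's theorem puts the subgroup among the roots, of which there are at most [#|A|]. *)
Lemma units_in_Fp_roots p (A : {group {unit 'F_p}}) :
  units_in_Fp A = roots_of_unity 'F_p #|A|.
Proof.
apply/eqP; rewrite eqEcard; apply/andP; split.
  apply/subsetP => _ /imsetP[u uA ->]; rewrite inE -FinRing.val_unitX.
  by rewrite expg_cardG.
rewrite [X in (_ <= X)%N]card_imset; last exact: val_inj.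
exact: card_roots_le (cardG_gt0 A) _.
Qed.


(** * Arithmetic combining the energy bounds *)

Definition energy_constant c d :=
  ((16 * (16 * c + 2 * d + 2)) ^ 8 * (16 * (d.+1 ^ 2 + c)))%N.

(** [S] stands for [#|3A|], [Ex] and [E] for the shifted multiplicative and the additive energy, [L]
    for the large cubes, [l] for the logarithm, [k] for about [n^2 / p]. The factors of
    [energy_constant] are the eighth power of the loss in [S] and the constant [g] in
    [E^2 <= g n^5 l]. *)
Lemma energy_arithmetic (c d n p l k S Ex E m L : nat) :
  (1 < n)%N -> (0 < p)%N -> (0 < l)%N -> (0 < k)%N ->
  (k * p <= n ^ 2 + p)%N -> (k ^ 2 <= 8 * n)%N ->
  (L <= 8 * c * n ^ 2 * l)%N ->
  (Ex <= n ^ 2 + d * k * n ^ 2 + 2 * L)%N -> (n.-1 ^ 4 <= S * Ex)%N ->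
  (E <= n ^ 2 + d * k * n ^ 2 + n * m)%N -> (m ^ 2 <= n * L)%N ->
  ((S * n) ^ 8 <= p ^ 9 * E ^ 2)%N ->
  (n <= energy_constant c d)%N \/ (n ^ 19 <= energy_constant c d * p ^ 9 * l ^ 9)%N.
Proof.
move=> n1 p0 l0 k0 hkp hk2 hL hEx hS hE hm hF.
have n0 : (0 < n)%N by exact: ltnW.
have n2n : (n <= 2 * n.-1)%N by clear -n1; lia.
rewrite /energy_constant; set b := (16 * c + 2 * d + 2)%N; set g := (16 * (d.+1 ^ 2 + c))%N.
set K := (_ * g)%N.
have hE2 : (E ^ 2 <= g * n ^ 5 * l)%N.
  have h1 : (E <= n ^ 2 * (d.+1 * k) + n * m)%N.
    by apply: leq_trans hE _; rewrite leq_add2r mulSn mulnDr leq_add ?leq_pmulr // mulnC.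
  have h2 : (E ^ 2 <= 2 * ((n ^ 2 * (d.+1 * k)) ^ 2 + (n * m) ^ 2))%N.
    apply: (@leq_trans ((n ^ 2 * (d.+1 * k) + n * m) ^ 2)); first by rewrite leq_exp2r.
    move: (n ^ 2 * (d.+1 * k))%N (n * m)%N => y z.
    by have := nat_Cauchy y z; rewrite sqrnD; case=> + _; lia.
  have h3 : ((n ^ 2 * (d.+1 * k)) ^ 2 <= n ^ 4 * d.+1 ^ 2 * (8 * n) * l)%N.
    apply: (@leq_trans (n ^ 4 * d.+1 ^ 2 * k ^ 2)); first by apply: eq_leq; ring.
    by rewrite -[X in (_ <= X)%N]mulnA leq_mul2l; apply/orP; right; apply: leq_trans hk2 _; rewrite leq_pmulr.
  have h4 : ((n * m) ^ 2 <= n ^ 2 * (n * (8 * c * n ^ 2 * l)))%N.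
    by rewrite expnMn leq_mul2l (leq_trans hm) ?orbT // leq_mul2l hL orbT.
  apply: leq_trans h2 _; apply: (@leq_trans (2 * (n ^ 4 * d.+1 ^ 2 * (8 * n) * l + n ^ 2 * (n * (8 * c * n ^ 2 * l))))).
    by rewrite leq_mul2l leq_add.
  by rewrite eq_leq // /g; ring.
have hF2 : ((S * n) ^ 8 <= p ^ 9 * (g * n ^ 5 * l))%N.
  by apply: leq_trans hF _; rewrite leq_mul2l hE2 orbT.
have hn4 : (n ^ 4 <= 16 * (S * Ex))%N.
  apply: (@leq_trans (16 * n.-1 ^ 4)); last by rewrite leq_mul2l hS.
  by rewrite -[16%N]/(2 ^ 4)%N -expnMn leq_exp2r.
have hEx2 : (Ex <= n ^ 2 * (1 + d * k + 16 * c * l))%N.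
  apply: leq_trans hEx _; apply: (@leq_trans (n ^ 2 + d * k * n ^ 2 + 2 * (8 * c * n ^ 2 * l))).
    by rewrite leq_add2l leq_mul2l hL.
  by rewrite eq_leq //; ring.
(* If [n^2 <= p l], then [k <= 2 l] and [S] is at least of order [n^2 / l], whence the bound on
   [n^19]. Otherwise [S] is at least of order [p], and the Fourier inequality bounds [n]
   outright. *)
case: (leqP (n ^ 2) (p * l)) => hcase; [right|left].
  have hk : (k <= 2 * l)%N.
    rewrite -(leq_pmul2r p0); apply: leq_trans hkp _.
    by apply: (@leq_trans (p * l + p * l)); [rewrite leq_add // leq_pmulr | rewrite eq_leq //; ring].
  have hEx3 : (Ex <= n ^ 2 * (b * l))%N.
    apply: leq_trans hEx2 _; rewrite leq_mul2l; apply/orP; right.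
    have hd : (d * k <= d * (2 * l))%N by rewrite leq_mul2l hk orbT.
    apply: (@leq_trans (2 * l + d * (2 * l) + 16 * c * l)); last by rewrite eq_leq // /b; ring.
    by rewrite leq_add2r leq_add // muln_gt0.
  have hS2 : (n ^ 2 <= 16 * b * l * S)%N.
    have n2 : (0 < n ^ 2)%N by rewrite expn_gt0 n0.
    rewrite -(leq_pmul2l n2); apply: (@leq_trans (16 * (S * Ex))).
      by apply: leq_trans hn4; rewrite eq_leq //; ring.
    apply: (@leq_trans (16 * (S * (n ^ 2 * (b * l))))); first by rewrite !leq_mul2l hEx3 orbT.
    by rewrite eq_leq //; ring.
  have n5 : (0 < n ^ 5)%N by rewrite expn_gt0 n0.
  rewrite -(leq_pmul2l n5); apply: (@leq_trans ((n ^ 2 * n) ^ 8)); first by rewrite eq_leq //; ring.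
  apply: (@leq_trans ((16 * b * l * S * n) ^ 8)); first by rewrite leq_exp2r // leq_mul2r hS2 orbT.
  apply: (@leq_trans ((16 * b * l) ^ 8 * (S * n) ^ 8)); first by rewrite -expnMn mulnA.
  apply: (@leq_trans ((16 * b * l) ^ 8 * (p ^ 9 * (g * n ^ 5 * l)))); first by rewrite leq_mul2l hF2 orbT.
  by rewrite eq_leq // /K; ring.
have hk : (k * p <= 2 * n ^ 2)%N.
  apply: leq_trans hkp _; rewrite mul2n -addnn leq_add2l.
  by apply: leq_trans (ltnW hcase); rewrite leq_pmulr.
have hp : (p <= 16 * b * S)%N.
  have n4 : (0 < n ^ 4)%N by rewrite expn_gt0 n0.
  rewrite -(leq_pmul2l n4); apply: (@leq_trans (16 * (S * Ex) * p)); first by rewrite leq_mul2r hn4 orbT.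
  apply: (@leq_trans (16 * (S * (n ^ 2 * (1 + d * k + 16 * c * l))) * p)).
    by rewrite leq_mul2r !leq_mul2l hEx2 !orbT.
  apply: (@leq_trans (16 * (S * (n ^ 2 * (p + d * (k * p) + 16 * c * (p * l)))))); first by rewrite eq_leq //; ring.
  apply: (@leq_trans (16 * (S * (n ^ 2 * (b * n ^ 2))))); last by rewrite eq_leq //; ring.
  rewrite !leq_mul2l; apply/orP; right; apply/orP; right; apply/orP; right.
  have h1 : (d * (k * p) <= d * (2 * n ^ 2))%N by rewrite leq_mul2l hk orbT.
  have h2 : (16 * c * (p * l) <= 16 * c * n ^ 2)%N by rewrite leq_mul2l (ltnW hcase) orbT.
  have h3 : (p <= n ^ 2)%N by apply: leq_trans (ltnW hcase); rewrite leq_pmulr.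
  apply: (@leq_trans (n ^ 2 + d * (2 * n ^ 2) + 16 * c * n ^ 2)); first by rewrite !leq_add.
  apply: (@leq_trans ((n ^ 2 + d * (2 * n ^ 2) + 16 * c * n ^ 2) + n ^ 2)); first exact: leq_addr.
  by rewrite eq_leq // /b; ring.
have h8 : ((p * n) ^ 8 <= K * p ^ 9 * n ^ 5 * l)%N.
  apply: (@leq_trans ((16 * b * S * n) ^ 8)); first by rewrite leq_exp2r // leq_mul2r hp orbT.
  apply: (@leq_trans ((16 * b) ^ 8 * (S * n) ^ 8)); first by rewrite -expnMn mulnA.
  apply: (@leq_trans ((16 * b) ^ 8 * (p ^ 9 * (g * n ^ 5 * l)))); first by rewrite leq_mul2l hF2 orbT.
  by rewrite eq_leq // /K; ring.
have pn : (0 < p ^ 8 * n ^ 7)%N by rewrite muln_gt0 !expn_gt0 p0 n0.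
rewrite -(leq_pmul2l pn).
apply: (@leq_trans ((p * n) ^ 8)); first by rewrite eq_leq //; ring.
apply: leq_trans h8 _; apply: (@leq_trans (K * (p ^ 8 * n ^ 5 * (p * l)))); first by rewrite eq_leq //; ring.
apply: (@leq_trans (K * (p ^ 8 * n ^ 5 * n ^ 2))); last by rewrite eq_leq //; ring.
by rewrite !leq_mul2l (ltnW hcase) !orbT.
Qed.

(** * The sixfold sumset of a subgroup *)

Section SixFold.
Variables (p : nat) (A : {group {unit 'F_p}}).
Hypothesis pp : prime p.
Local Notation F := 'F_p.
Local Notation n := #|A|.
Local Notation A' := (units_in_Fp A).

Let n0 : (0 < n)%N. Proof. exact: cardG_gt0. Qed.
Let p0 : (0 < p)%N. Proof. exact: prime_gt0. Qed.
Let cardF : #|F| = p. Proof. exact: card_Fp. Qed.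

Lemma card_units_in_Fp : #|A'| = n.
Proof. by rewrite card_imset //; exact: val_inj. Qed.

Lemma units_in_Fp_neq0 x : x \in A' -> x != 0.
Proof. by rewrite units_in_Fp_roots => /(roots_neq0 n0). Qed.

Lemma units_in_Fp_mul x y : x \in A' -> y \in A' -> x * y \in A'.
Proof. by rewrite !units_in_Fp_roots !inE exprMn => /eqP-> /eqP->; rewrite mulr1. Qed.

Lemma units_in_Fp_inv x : x \in A' -> x^-1 \in A'.
Proof. by rewrite !units_in_Fp_roots !inE exprVn => /eqP->; rewrite invr1. Qed.

Lemma units_in_Fp1 : 1 \in A'.
Proof. by rewrite units_in_Fp_roots inE expr1n. Qed.

Lemma card_units_lt : (n < p)%N.
Proof.
suff : (#|A'| < #|[set: F]|)%N by rewrite card_units_in_Fp cardsT cardF.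
apply: proper_card; apply/properP; split; first exact: subsetT.
by exists 0 => //; apply/negP => /units_in_Fp_neq0; rewrite eqxx.
Qed.

Lemma gap_card (B C : {set F}) :
  (forall b c, b \in B -> c \in C -> b + c \notin A') ->
  (#|B| * #|C| * n ^ 2 <= p ^ 3)%N.
Proof.
move=> gap; have [e [eD en es]] := exists_character pp.
have A0 : (0 < #|A'|)%N by rewrite card_units_in_Fp.
have := sumset_gap eD en es (Q := #|F|%:R)
  (fun xi => fourier_set_le_card eD en es units_in_Fp_neq0 units_in_Fp_mul A0 (xi := xi)) gap.
by rewrite card_units_in_Fp cardF -exprS -natrX ler_nat.
Qed.

(** The coefficient of [a A] at [xi] is that of [A] at [xi * a], so the energy bound applies with
    [Q] the fourth root of [p E^2]; a fourth power then removes the root. *)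
Lemma gap_energy (a : F) (B C : {set F}) : a != 0 ->
  (forall b c, b \in B -> c \in C -> b + c \notin [set a * x | x in A']) ->
  ((#|B| * #|C| * n ^ 2) ^ 4 <= p ^ 9 * additive_energy F n ^ 2)%N.
Proof.
move=> a0 gap; have [e [eD en es]] := exists_character pp.
have A0 : (0 < #|A'|)%N by rewrite card_units_in_Fp.
set E := additive_energy _ _.
pose M : algC := p%:R * E%:R ^+ 2.
have M0 : 0 <= M by rewrite mulr_ge0 ?exprn_ge0 ?ler0n.
have inj_a : injective (fun x : F => a * x) by apply: mulfI.
have hQ xi : xi != 0 -> `|fourier_set e [set a * x | x in A'] xi| ^+ 2 <= 4.-root M.
  move=> xi0.
  have -> : fourier_set e [set a * x | x in A'] xi = fourier_set e A' (xi * a).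
    rewrite /fourier_set big_imset /=; last by move=> x y _ _; apply: inj_a.
    by apply: eq_bigr => x _; rewrite mulrA.
  rewrite -(@ler_pXn2r _ 4) // ?nnegrE ?exprn_ge0 ?rootC_ge0 // rootCK //.
  have := fourier_set_le_energy eD en es units_in_Fp_neq0 units_in_Fp_mul A0 (mulf_neq0 xi0 a0).
  by rewrite cardF [in collisions _ _]units_in_Fp_roots.
have := sumset_gap eD en es hQ gap.
rewrite card_imset // card_units_in_Fp cardF => h.
rewrite -(ler_nat algC) natrX.
apply: le_trans (_ : (4.-root M * p%:R ^+ 2) ^+ 4 <= _).
  by rewrite ler_pXn2r // ?nnegrE ?ler0n // mulr_ge0 ?rootC_ge0 ?exprn_ge0 ?ler0n.
by rewrite exprMn rootCK // /M natrM !natrX -exprM mulrAC -exprS.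
Qed.

(** Cauchy-Schwarz for [(a + 1)(b + 1)], whose values minus 1 are [a b + a + b]. Deleting [-1] costs
    at most one element, hence [n.-1]. *)
Lemma shift_energy_card :
  (n.-1 ^ 4 <= #|sumset 3 A'| * collisions (setX (roots_of_unity F n :\ (-1)%R)
     (roots_of_unity F n :\ (-1)%R)) (@shift_product F))%N.
Proof.
set B := _ :\ _; have cB : (n.-1 <= #|B|)%N.
  rewrite -card_units_in_Fp units_in_Fp_roots (cardsD1 (-1)) -/B.
  by case: (_ \in _); rewrite ?add0n ?add1n //= leq_pred.
apply: (@leq_trans (#|setX B B| ^ 2)).
  by rewrite cardsX -mulnn !expnS !expn0 !muln1 -!mulnA !leq_mul.
apply: leq_trans (card_sqr_le_collisions _ (@shift_product F)) _.
rewrite leq_mul2r; apply/orP; right.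
rewrite -(card_imset _ (subIr 1)); apply: subset_leq_card.
apply/subsetP => _ /imsetP[_ /imsetP[[a b] + ->] ->].
rewrite in_setX !in_setD1 -units_in_Fp_roots /shift_product /= => /andP[/andP[_ aA] /andP[_ bA]].
have -> : (a + 1) * (b + 1) - 1 = a * b + a + b by ring.
by apply: (@sumsetD _ _ 2 1); first apply: (@sumsetD _ _ 1 1); apply: sumset1 => //; apply: units_in_Fp_mul.
Qed.

(** No sum of an element of [-A] and one outside [2A] lies in [A], so the gap inequality leaves
    fewer than [p / 2] elements outside [2A]. Then [2A] and [x - 2A] must meet. *)
Lemma sumset4_full x : (2 * p ^ 2 < n ^ 3)%N -> x \in sumset 4 A'.
Proof.
move=> hn; set D := sumset 2 A'.
have : (#|[set - y | y in A']| * #|~: D| * n ^ 2 <= p ^ 3)%N.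
  apply: gap_card => _ c /imsetP[b bA ->]; rewrite inE; apply: contra => h.
  have -> : c = b + (- b + c) by ring.
  by apply: (@sumsetD _ _ 1 1); apply: sumset1.
rewrite card_imset; last exact: oppr_inj.
rewrite card_units_in_Fp => h.
have hC : (2 * #|~: D| < p)%N.
  rewrite ltnNge; apply/negP => hp; move: hn; rewrite ltnNge => /negP; apply.
  rewrite -(leq_pmul2l p0); apply: (@leq_trans (2 * #|~: D| * n ^ 3)); first by rewrite leq_mul2r hp orbT.
  apply: (@leq_trans (2 * (n * #|~: D| * n ^ 2))); first by rewrite eq_leq //; ring.
  by apply: (@leq_trans (2 * p ^ 3)); [rewrite leq_mul2l h | rewrite eq_leq //; ring].
pose D' := [set x - y | y in D].
have cD' : #|D'| = #|D| by rewrite card_imset // => y z /addrI/oppr_inj.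
have hcard : (#|D| + #|~: D| = p)%N by rewrite cardsC cardF.
have : (0 < #|D :&: D'|)%N.
  have hU : (#|D :|: D'| <= p)%N by rewrite -[X in (_ <= X)%N]cardF max_card.
  have := cardsUI D D'; rewrite cD'; move: hC hcard hU.
  by move: #|D| #|~: D| #|D :|: D'| #|D :&: D'| => *; lia.
rewrite card_gt0 => /set0Pn[z /setIP[zD /imsetP[y yD E]]].
rewrite -(subrK y x) -E.
by apply: (@sumsetD _ _ 2 2).
Qed.

Lemma sumset6_of_card K :
  (energy_constant (27 * 128 ^ 2) 512 <= K)%N -> (512 ^ 2 <= K)%N ->
  (K < n)%N -> (K * p ^ 9 * (trunc_log 2 n).+1 ^ 9 < n ^ 19)%N ->
  [set x : F | x != 0] \subset sumset 6 A'.
Proof.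
move=> cK K_big Kn hn; have n_big := leq_trans K_big (ltnW Kn).
apply/subsetP => a; rewrite inE => a0; apply: contraT => a6.
have A1 := sumset1 units_in_Fp1.
(* Otherwise [a - 1 - 1] lies in [4A], and adding 1 twice puts [a] in [6A]. *)
have n3 : (n ^ 3 <= 2 * p ^ 2)%N.
  rewrite leqNgt; apply: contra a6 => /(sumset4_full (a - 1 - 1)) h.
  rewrite -(subrK 1 a) -(subrK 1 (a - 1)).
  by apply: (@sumsetD _ _ 5 1) => //; apply: (@sumsetD _ _ 4 1).
(* n^2 <= k p keeps the auxiliary polynomials of degree below p. *)
set k := (n ^ 2 %/ p).+1; set l := (trunc_log 2 n).+1 in hn *.
have hk1 : (n ^ 2 <= k * p)%N by apply/ltnW/ltn_ceil.
have hk2 : (k * p <= n ^ 2 + p)%N by rewrite mulSn addnC leq_add2r leq_trunc_div.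
(* [p (k - 1) <= n^2] and [n^3 <= 2 p^2] give [(k - 1)^2 <= 2 n]; then [k = 1] or
   [k <= 2 (k - 1)]. *)
have k2n : (k ^ 2 <= 8 * n)%N.
  have h1 : (k.-1 ^ 2 <= 2 * n)%N.
    have pn : (0 < p ^ 2 * n)%N by rewrite muln_gt0 expn_gt0 p0.
    rewrite -(@leq_pmul2l (p ^ 2)) ?expn_gt0 ?p0 //.
    apply: (@leq_trans ((n ^ 2) ^ 2)).
      by rewrite mulnC -expnMn leq_exp2r // leq_trunc_div.
    apply: (@leq_trans (n * n ^ 3)); first by rewrite eq_leq //; ring.
    by apply: (@leq_trans (n * (2 * p ^ 2))); [rewrite leq_mul2l n3 orbT | rewrite eq_leq //; ring].
  move: h1; rewrite /k /=; move: (_ %/ _)%N => [|j]; first by move=> _; rewrite exp1n muln_gt0.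
  move=> h; apply: (@leq_trans ((2 * j.+1) ^ 2)); first by rewrite leq_exp2r //; lia.
  by rewrite expnMn (_ : 8 = 2 ^ 2 * 2)%N // -mulnA leq_mul2l h orbT.
(* After squaring, [16^2 (8 n)^3 <= 512^2 n^3 <= n^4]; this is where [n >= 512^2] is needed. *)
have h16 : (16 * k ^ 3 <= n ^ 2)%N.
  rewrite -(@leq_exp2r _ _ 2) //.
  apply: (@leq_trans (16 ^ 2 * (k ^ 2) ^ 3)); first by rewrite eq_leq //; ring.
  apply: (@leq_trans (16 ^ 2 * (8 * n) ^ 3)); first by rewrite leq_mul2l leq_exp2r // k2n.
  apply: (@leq_trans (512 ^ 2 * n ^ 3)); last first.
    by apply: (@leq_trans (n * n ^ 3)); [rewrite leq_mul2r n_big orbT | rewrite eq_leq //; ring].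
  by rewrite expnMn mulnA leq_mul2r -(mulnn 512) leq_mul ?orbT.
have hL := large_cubes_le n0 (char_ge_Fp pp) (ltnW card_units_lt) hk1 h16.
have [m hE hm] := additive_energy_le F n0 (512 * k).
have hEx := shift_energy_le F n0 (512 * k).
set S := sumset 3 A'.
have hF : ((#|S| * n) ^ 8 <= p ^ 9 * additive_energy F n ^ 2)%N.
  (* Both summands are taken in [3A]: if [b + c = a x] with [x] in [A], then [a = x^-1 (b + c)] lies
     in [6A]. *)
  rewrite (_ : (#|S| * n) ^ 8 = (#|S| * #|S| * n ^ 2) ^ 4)%N; last by ring.
  apply: (gap_energy a0) => b c bS cS; apply: contra a6 => /imsetP[x xA E].
  have -> : a = x^-1 * (b + c).
    by rewrite E mulrCA mulVf ?mulr1 // units_in_Fp_neq0.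
  apply: sumsetM; last exact: (@sumsetD _ _ 3 3).
  by move=> y yA; apply: units_in_Fp_mul => //; apply: units_in_Fp_inv.
have n1 : (1 < n)%N by apply: leq_trans n_big.
have [h|h] := energy_arithmetic n1 p0 (ltn0Sn _) (ltn0Sn _)
  hk2 k2n hL hEx shift_energy_card hE hm hF.
  by move: Kn; rewrite ltnNge (leq_trans h cK).
move: hn; rewrite ltnNge => /negP[]; apply: leq_trans h _.
by rewrite leq_mul2r; apply/orP; right; rewrite leq_mul2r cK orbT.
Qed.
End SixFold.

(** * The size hypothesis over the reals *)

Section Size.
Variable R : realType.

Lemma half_le_ln2 : 2^-1 <= ln 2 :> R.
Proof.
rewrite -ler_expR lnK ?posrE ?ltr0n //.
have := expR_ge1Dx (- 2^-1 : R); rewrite expRN => h.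
have e0 : 0 < expR 2^-1 :> R := expR_gt0 _.
by move: h; rewrite -(ler_pM2r e0) mulVf ?lt0r_neq0 // => h; lra.
Qed.

Lemma trunc_log_le_ln n : (1 < n)%N -> (trunc_log 2 n).+1%:R <= 4 * ln n%:R :> R.
Proof.
move=> n1; have n0 : (0 < n)%N by exact: ltnW.
have l2 := half_le_ln2.
have h1 : ln 2 <= ln n%:R :> R by rewrite ler_ln ?posrE ?ltr0n // ler_nat.
have h2 : (trunc_log 2 n)%:R * ln 2 <= ln n%:R :> R.
  rewrite mulr_natl -lnXn ?ltr0n // -natrX ler_ln ?posrE ?ltr0n ?expn_gt0 //.
  by rewrite ler_nat; apply: trunc_logP.
have h3 : (trunc_log 2 n)%:R * 2^-1 <= (trunc_log 2 n)%:R * ln 2 :> R.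
  by rewrite ler_wpM2l.
by rewrite -natr1; lra.
Qed.

Lemma powR_pow23 (a : R) k : 0 <= a -> (a `^ (k%:R / 23%:R)) ^+ 23 = a ^+ k.
Proof.
move=> a0; rewrite -powR_mulrn ?powR_ge0 // -powRrM divfK ?pnatr_eq0 //.
by rewrite powR_mulrn.
Qed.

(** The hypothesis to the power [23 * 19] is compared with the goal to the power 23: [11 * 19 = 209]
    against [9 * 23 = 207] for [p], and [15 * 19 = 285] against 207 for the logarithm. *)
Lemma size_condition (K : nat) : exists2 C : R, 0 < C & forall p n : nat,
  (0 < p)%N -> (1 < n)%N ->
  C * (p%:R `^ (11%:R / 23%:R) * ln n%:R `^ (15%:R / 23%:R)) <= n%:R ->
  (K < n)%N /\ (K * p ^ 9 * (trunc_log 2 n).+1 ^ 9 < n ^ 19)%N.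
Proof.
pose u : R := K.+1%:R; have u1 : 1 <= u by rewrite ler1n.
have u0 : 0 <= u := le_trans ler01 u1.
have Ku : K%:R < u by rewrite ltr_nat.
exists (16 * u) => [|p n p0 n1 hC]; first by rewrite mulr_gt0 // (lt_le_trans ltr01).
(* The factor 2 makes [y >= 1] already for [n = 2], so powers of [y] grow with the exponent. *)
have [y yE] : exists y : R, y = 2 * ln n%:R by eexists.
set x : R := p%:R.
have x1 : 1 <= x by rewrite ler1n.
have y1 : 1 <= y.
  have : ln 2 <= ln n%:R :> R by rewrite ler_ln ?posrE ?ltr0n ?ler_nat // (leq_trans _ n1).
  by have := half_le_ln2; rewrite yE; lra.
have x0 : 0 <= x := le_trans ler01 x1.
have y0 : 0 <= y := le_trans ler01 y1.
have L0 : 0 <= ln n%:R :> R by move: y0; rewrite yE; lra.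
(* [16^23] dominates [2^26]: [2^15] comes from [y = 2 ln n], and the spare [2^11] gives
   [2^209 >= 2^207] below. *)
have h23 : 2 ^+ 11 * u ^+ 23 * x ^+ 11 * y ^+ 15 <= n%:R ^+ 23.
  apply: le_trans (_ : (16 * u * (x `^ (11%:R / 23%:R) * ln n%:R `^ (15%:R / 23%:R))) ^+ 23 <= _).
    rewrite !exprMn !powR_pow23 // yE exprMn.
    have -> : 16 ^+ 23 * u ^+ 23 * (x ^+ 11 * ln n%:R ^+ 15) =
      16 ^+ 23 * (u ^+ 23 * x ^+ 11 * ln n%:R ^+ 15) by ring.
    have -> : 2 ^+ 11 * u ^+ 23 * x ^+ 11 * (2 ^+ 15 * ln n%:R ^+ 15) =
      2 ^+ 26 * (u ^+ 23 * x ^+ 11 * ln n%:R ^+ 15) by rewrite -[26%N]/(11 + 15)%N exprD; ring.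
    apply: ler_wpM2r; first by rewrite !mulr_ge0 // exprn_ge0.
    rewrite (_ : 16 = 2 ^+ 4) -?exprM ?ler_weXn2l ?ler1n //.
    by rewrite -natrX.
  by rewrite lerXn2r // nnegrE ?ler0n // !mulr_ge0 // powR_ge0.
split.
  rewrite -(ltr_nat R); apply: lt_le_trans Ku _.
  rewrite -(@ler_pXn2r _ 23) // ?nnegrE ?ler0n //; apply: le_trans h23.
  have h1 : 1 <= 2 ^+ 11 :> R by rewrite exprn_ege1 // ler1n.
  have h2 : 1 <= x ^+ 11 by rewrite exprn_ege1.
  have h3 : 1 <= y ^+ 15 by rewrite exprn_ege1.
  rewrite -[X in X <= _]mul1r -[X in X <= _]mulr1 -[X in X <= _]mulr1.
  by rewrite !ler_pM ?mulr_ge0 ?exprn_ge0.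
rewrite -(ltr_nat R) [(n ^ 19)%:R]natrX 2!natrM 2!natrX -/x.
apply: (@le_lt_trans _ _ (K%:R * x ^+ 9 * (2 * y) ^+ 9)).
  rewrite ler_wpM2l ?mulr_ge0 ?ler0n ?exprn_ge0 // lerXn2r ?nnegrE ?ler0n ?mulr_ge0 //.
  by have := trunc_log_le_ln n1; rewrite yE; lra.
apply: (@lt_le_trans _ _ (u * x ^+ 9 * (2 * y) ^+ 9)).
  have x_gt0 : 0 < x := lt_le_trans ltr01 x1.
  have y_gt0 : 0 < y := lt_le_trans ltr01 y1.
  have : 0 < x ^+ 9 * (2 * y) ^+ 9 by rewrite mulr_gt0 ?exprn_gt0 ?mulr_gt0.
  by rewrite -[K%:R * _ * _]mulrA -[u * _ * _]mulrA => h; rewrite ltr_pM2r.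
rewrite -(@ler_pXn2r _ 23) // ?nnegrE ?mulr_ge0 ?exprn_ge0 ?ler0n ?mulr_ge0 //.
rewrite -exprM [(19 * 23)%N]mulnC exprM.
apply: le_trans (_ : (2 ^+ 11 * u ^+ 23 * x ^+ 11 * y ^+ 15) ^+ 19 <= _); last first.
  by rewrite lerXn2r // nnegrE ?exprn_ge0 ?mulr_ge0 ?exprn_ge0 ?ler0n.
have mul3 k (a b c : R) : (a * b * c) ^+ k = a ^+ k * b ^+ k * c ^+ k by rewrite 2!exprMn.
have -> : (u * x ^+ 9 * (2 * y) ^+ 9) ^+ 23 = 2 ^+ 207 * u ^+ 23 * x ^+ 207 * y ^+ 207.
  have swap (a b c d : R) : a * b * (c * d) = c * a * b * d by ring.
  by rewrite mul3 -!exprM (exprMn _ 2 y) swap.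
have -> : (2 ^+ 11 * u ^+ 23 * x ^+ 11 * y ^+ 15) ^+ 19 = 2 ^+ 209 * u ^+ 437 * x ^+ 209 * y ^+ 285.
  by rewrite (exprMn 19 (_ * _) (y ^+ 15)) mul3 -!exprM.
have le_mul4 (a b c d a' b' c' d' : R) : 0 <= a -> 0 <= b -> 0 <= c -> 0 <= d ->
    a <= a' -> b <= b' -> c <= c' -> d <= d' -> a * b * c * d <= a' * b' * c' * d'.
  by move=> *; rewrite !ler_pM ?mulr_ge0.
by apply: le_mul4; first [exact: exprn_ge0 | apply: ler_weXn2l => //; exact: ler1n].
Qed.
End Size.

(* The implied constant C of the hypothesis |A| >> ... is absolute: it is chosen
   before p and A.  The hypothesis 1 < #|A| excludes only the trivial subgroup,
   where ln #|A| = 0 would make the size condition vacuous. *)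
Theorem theorem14 (R : realType) :
  exists2 C : R, 0 < C &
    forall (p : nat) (A : {group {unit 'F_p}}),
      prime p ->
      (1 < #|A|)%N ->
      C * (p%:R `^ (11%:R / 23%:R) * ln (#|A|%:R) `^ (15%:R / 23%:R))
        <= #|A|%:R ->
      units_in_Fp [set: {unit 'F_p}] \subset sumset 6 (units_in_Fp A).
Proof.
(* The first term covers the case where [n] is bounded outright, the second the requirement
   [n >= 512^2]. *)
pose K := (energy_constant (27 * 128 ^ 2) 512 + 512 ^ 2)%N.
have [C C0 hC] := size_condition R K.
exists C => // p A pp A1 /(hC _ _ (prime_gt0 pp) A1)[hK h19].
apply: subset_trans (sumset6_of_card pp (leq_addr _ _) (leq_addl _ _) hK h19).
by apply/subsetP => _ /imsetP[u _ ->]; rewrite inE -unitfE; exact: valP u.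
Qed.
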